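(* Suppose that $\lambda:[0,\infty[\,\to\,]0,\infty[$ is of bounded variation on $[0,T]$ and $\inf\lambda([0,T])>0$ for every $0<T<\infty$. Let $v_0\in\partial\varphi(x_0)$ and $v_0\neq0$. Then there exists a unique strong solution $(x,v):[0,\infty[\,\to H\times H$ of the Cauchy problem $$\lambda(t)\dot x(t)+\dot v(t)+v(t)+\nabla\psi(x(t))=0,\qquad v(t)\in\partial\varphi(x(t)),\qquad x(0)=x_0,\quad v(0)=v_0,$$ where the first equality holds for almost all $t\in[0,\infty[$ and the inclusion holds for all $t\in[0,\infty[$.
   Context: $H$ is a real Hilbert space. The function $\varphi:H\to\mathbb{R}\cup\{+\infty\}$ is convex, lower semicontinuous and proper, with convex subdifferential $\partial\varphi$. The function $\psi:H\to\mathbb{R}$ is convex and differentiable, and $\nabla\psi$ is Lipschitz continuous on the bounded subsets of $H$. The function $\varphi+\psi$ is bounded from below on $H$. Bounded variation of $\lambda$ on $[0,T]$ means $\sup\sum_{i=1}^p|\lambda(\tau_i)-\lambda(\tau_{i-1})|<+\infty$, the supremum being over all $p\in\mathbb{N}$ and all strictly increasing sequences $\tau_0<\tau_1<\cdots<\tau_p$ of points of $[0,T]$; $\lambda$ may have jumps. A strong solution on $[0,\infty[$ is a pair $(x,v)$ of functions $x,v:[0,\infty[\,\to H$, absolutely continuous on each bounded interval $[0,b]$, satisfying the equation for almost every $t$, the inclusion for all $t$, and the initial conditions. *)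

(* Defs.v *)
(* Library: MathComp / MathComp-Analysis. *)
From HB Require Import structures.
From mathcomp Require Import all_boot all_order all_algebra.
From mathcomp Require Import all_classical all_reals all_analysis.

Set Implicit Arguments.
Unset Strict Implicit.
Unset Printing Implicit Defensive.

Import Order.TTheory GRing.Theory Num.Theory.
Import numFieldNormedType.Exports.

Local Open Scope classical_set_scope.
Local Open Scope ring_scope.

(* A real Hilbert space is a complete normed module H over R : realType whose
   norm is induced by the positive definite symmetric bilinear form ip. *)
Definition hilbert_dot (R : realType) (H : completeNormedModType R)
    (ip : {dot H for @idfun R}) : Prop :=
  forall u : H, `|u| ^+ 2 = ip u u.

(* The endpoints of the segment are left out, so that the convention for
   0 * +oo plays no role. *)
Definition convex_efun (R : realType) (H : lmodType R) (f : H -> \bar R) : Prop :=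
  forall (x y : H) (t : R), 0 < t -> t < 1 ->
    (f (t *: x + (1 - t) *: y)%R <= t%:E * f x + (1 - t)%:E * f y)%E.

(* The first conjunct says that f takes its values in R `|` {+oo}. *)
Definition proper_efun (R : realType) (T : Type) (f : T -> \bar R) : Prop :=
  (forall x, (-oo < f x)%E) /\ (exists x, (f x < +oo)%E).

(* For a proper f this set is empty at every x such that f x = +oo. *)
Definition subdifferential (R : realType) (H : completeNormedModType R)
    (ip : {dot H for @idfun R}) (f : H -> \bar R) (x : H) : set H :=
  [set v | forall y : H, (f x + (ip v (y - x)%R)%:E <= f y)%E].

(* Riesz representative of the Frechet differential of f at x. It is the usual
   gradient where f is differentiable and H is a Hilbert space; the default
   value 0 is returned if there is no representative. *)
Definition gradient (R : realType) (H : completeNormedModType R)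
    (ip : {dot H for @idfun R}) (f : H -> R) (x : H) : H :=
  xget 0 [set g : H | forall u : H, 'd f x u = ip g u].

Definition lipschitz_on_bounded_sets (R : realType) (V W : normedModType R)
    (f : V -> W) : Prop :=
  forall B : set V, bounded_set B -> [lipschitz f x | x in B].

Definition abs_continuous_on (R : realType) (H : normedModType R)
    (a b : R) (f : R -> H) : Prop :=
  forall e : R, 0 < e -> exists2 d : R, 0 < d &
    forall (n : nat) (l r : 'I_n -> R),
      (forall i, a <= l i /\ l i <= r i /\ r i <= b) ->
      trivIset setT (fun i => `]l i, r i[%classic) ->
      \sum_(i < n) (r i - l i) < d ->
      \sum_(i < n) `|f (r i) - f (l i)| < e.

(* Functions on [0, +oo[ are represented by functions on R; nothing below
   depends on the values at t < 0: the only condition that could see them is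
   the derivative at t = 0, and {0} is Lebesgue negligible. *)
Definition strong_solution (R : realType) (H : completeNormedModType R)
    (ip : {dot H for @idfun R}) (phi : H -> \bar R) (psi : H -> R)
    (lambda : R -> R) (x0 v0 : H) (x v : R -> H) : Prop :=
  [/\ forall b : R, 0 < b -> abs_continuous_on 0 b x,
      forall b : R, 0 < b -> abs_continuous_on 0 b v,
      {ae @lebesgue_measure R, forall t : R, 0 <= t ->
         [/\ derivable x t 1, derivable v t 1 &
             lambda t *: derive1 x t + derive1 v t + v t + gradient ip psi (x t) = 0]},
      forall t : R, 0 <= t -> subdifferential ip phi (x t) (v t) &
      x 0 = x0 /\ v 0 = v0].

(* Main.v *)
Require Import Defs.
From HB Require Import structures.
From mathcomp Require Import all_boot all_order all_algebra.
From mathcomp Require Import all_classical all_reals all_analysis.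
From mathcomp Require Import ring lra zify.
Import Order.TTheory GRing.Theory Num.Theory.
Import numFieldNormedType.Exports.
Local Open Scope classical_set_scope.
Local Open Scope ring_scope.
Set Implicit Arguments.
Unset Strict Implicit.
Unset Printing Implicit Defensive.

(** For constant [lam] the equation is an ordinary differential equation for
[lam x + v]: by monotonicity of the subdifferential, the difference [(X, V)] of
two points of its graph satisfies [ip X V >= 0], so [|lam X + V|] dominates both
[lam |X|] and [|V|], and Minty's theorem recovers [(x, v)] from [lam x + v].
When [lam] has bounded variation, replacing it on a time interval of length [h]
by its value at the left end changes the integrated equation, along Lipschitz
curves, by at most a constant times [h] times the variation of [lam] over that
interval. The variations over the cells of a grid add up to at most the total
variation, so the accumulated error is O(h), while a change of the coefficient
between two cells multiplies [|lam X + V|] by at most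
[1 + |change of lam| / min lam]. Hence a discrete Gronwall inequality
([discrete_stability], [grid_stability]) compares on a grid any two curves
that satisfy the equation up to such errors, and gives both halves of the
theorem.

Existence. An Euler scheme, implicit in the gradient of [psi], is solvable by
[minty]. Along it [phi + psi] decreases, which bounds the positions on bounded
time intervals independently of the step; monotonicity then bounds [v] and both
velocities ([euler_bounds_exist]). By [grid_stability] the schemes of steps
[2^-n] converge, and their limit is a locally Lipschitz curve in the graph for
which the defect in the equation over [[s, t]] is O((t - s)(V t - V s + t - s))
wherever the cumulative variation [V] of [lam] is continuous ([euler_limit]).
At such a point, if [x] and [v] are differentiable there, the equation holds.

Differentiability. A Lipschitz curve in a Hilbert space is differentiable
almost everywhere ([lipschitz_derivable_ae]). The sums [sum |f b - f a|^2/(b - a)]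
over partitions are bounded and grow under refinement. Near the supremum,
replacing [f] by a polygonal curve leaves a remainder of small energy, and a
Vitali covering argument ([monotone_maximal_inequality]) shows that outside a set
of small measure the remainder has small difference quotients. The same
inequality gives the continuity of [V] almost everywhere.

Uniqueness. For a strong solution, monotonicity bounds the velocities almost
everywhere, hence the solution is Lipschitz by [abs_continuous_bound], and so it
satisfies the same estimate of the defect ([strong_solution_consistent]).
Two strong solutions therefore differ by O(T / N) at time [T], for every [N]. *)

(** * Inner products and completeness *)

Section InnerProduct.
Context {R : realType} {H : completeNormedModType R} (ip : {dot H for @idfun R})
  (hH : hilbert_dot ip).
Implicit Types (u v w : H) (a b c : R).

Lemma ipC u v : ip u v = ip v u.
Proof. by rewrite hermC expr0 mul1r. Qed.

Lemma ipDl u v w : ip (u + v) w = ip u w + ip v w.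
Proof. by rewrite linearDl. Qed.

Lemma ipZl a u w : ip (a *: u) w = a * ip u w.
Proof. by rewrite linearZl_LR. Qed.

Lemma ipNl u w : ip (- u) w = - ip u w.
Proof. by rewrite linearNl. Qed.

Lemma ipDr u v w : ip w (u + v) = ip w u + ip w v.
Proof. by rewrite linearDr. Qed.

Lemma ipZr a u w : ip w (a *: u) = a * ip w u.
Proof. by rewrite linearZr_LR. Qed.

Lemma ipNr u w : ip w (- u) = - ip w u.
Proof. by rewrite linearNr. Qed.

Lemma ip0l w : ip 0 w = 0.
Proof. by rewrite linear0l. Qed.

Lemma ip0r w : ip w 0 = 0.
Proof. by rewrite linear0r. Qed.

Lemma ip_ext u v : (forall w, ip u w = ip v w) -> u = v.
Proof.
move=> uv; apply/eqP; rewrite -subr_eq0 -normr_eq0 -sqrf_eq0 hH.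
by rewrite ipDl ipNl uv subrr.
Qed.

Lemma cauchy_schwarz u v : `|ip u v| <= `|u| * `|v|.
Proof.
have [->|v0] := eqVneq v 0; first by rewrite ip0r !normr0 mulr0.
have vv : 0 < ip v v by rewrite -hH exprn_gt0// normr_gt0.
rewrite -(ler_pXn2r (n := 2)) ?nnegrE ?mulr_ge0//.
rewrite exprMn !hH real_normK ?num_real//.
pose a := ip u v / ip v v.
have : 0 <= ip (u - a *: v) (u - a *: v) by rewrite -hH exprn_ge0.
rewrite !(ipDl, ipDr, ipNl, ipNr, ipZl, ipZr) (ipC v u) => h.
have av : a * ip v v = ip u v by rewrite /a mulfVK ?gt_eqF.
have av2 : a * (a * ip v v) = a * ip u v by rewrite av.
have {h}: 0 <= ip u u - a * ip u v by move: h av2; lra.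
move=> /(ler_wpM2r (ltW vv)); rewrite mul0r mulrBl mulrAC av subr_ge0 expr2.
by [].
Qed.

Lemma ip_le u v : ip u v <= `|u| * `|v|.
Proof. exact: le_trans (ler_norm _) (cauchy_schwarz u v). Qed.

Lemma ip_ge u v : - (`|u| * `|v|) <= ip u v.
Proof. by have := cauchy_schwarz u v; rewrite ler_norml => /andP[]. Qed.

Lemma sqnormD u v : `|u + v| ^+ 2 = `|u| ^+ 2 + 2 * ip u v + `|v| ^+ 2.
Proof. by rewrite !hH !(ipDl, ipDr) (ipC v u); ring. Qed.

(** If [ip u v >= 0] then [|a u + v|^2 >= |a u|^2 + |v|^2], so that the norm of
[a *: u + v] controls both components. *)
Lemma monotone_normr u v a : 0 <= a -> 0 <= ip u v -> `|v| <= `|a *: u + v|.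
Proof.
move=> a0 uv; rewrite -(ler_pXn2r (n := 2)) ?nnegrE//.
rewrite sqnormD ipZl; have := exprn_ge0 2 (normr_ge0 (a *: u)).
by have := mulr_ge0 a0 uv; lra.
Qed.

Lemma monotone_norml u v a : 0 <= a -> 0 <= ip u v -> a * `|u| <= `|a *: u + v|.
Proof.
move=> a0 uv; rewrite -[a in a * _]ger0_norm// -normrZ.
rewrite -(ler_pXn2r (n := 2)) ?nnegrE//.
rewrite sqnormD ipZl; have := exprn_ge0 2 (normr_ge0 v).
by have := mulr_ge0 a0 uv; lra.
Qed.

Lemma cvg_ip (T : Type) (F : set_system T) (FF : Filter F) (f f' : T -> H) (a b : H) :
  f t @[t --> F] --> a -> f' t @[t --> F] --> b -> ip (f t) (f' t) @[t --> F] --> ip a b.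
Proof.
move=> fa fb.
have polar u v : ip u v = (`|u + v| * `|u + v| - `|u| * `|u| - `|v| * `|v|) / 2.
  by rewrite -!expr2 sqnormD; field.
rewrite polar (_ : (fun t => _) = fun t =>
  (`|f t + f' t| * `|f t + f' t| - `|f t| * `|f t| - `|f' t| * `|f' t|) / 2); last first.
  by apply/funext => t; rewrite polar.
have sq (h : T -> H) l : h t @[t --> F] --> l -> `|h t| * `|h t| @[t --> F] --> `|l| * `|l|.
  by move=> hl; apply: cvgM; exact: cvg_norm.
apply: cvgM; last exact: cvg_cst.
by apply: cvgB; [apply: cvgB|]; apply: sq => //; exact: cvgD.
Qed.

End InnerProduct.

Lemma cauchy_sequence_cvg {R : realType} {H : completeNormedModType R} (u : nat -> H) :
  (forall e : R, 0 < e -> exists N, forall n, (N <= n)%N -> `|u N - u n| < e) ->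
  exists l : H, u n @[n --> \oo] --> l.
Proof.
move=> uC; suff /cauchy_cvgP/cvg_ex : cauchy (u n @[n --> \oo]) by [].
apply: cauchy_exP => e e0; have [N uN] := uC _ e0; exists (u N).
by exists N => // n /= Nn; rewrite -ball_normE; exact: uN.
Qed.

(** * Minimization of strongly convex functions *)

Section Minimization.
Context {R : realType} {H : completeNormedModType R}.

Lemma ler_sqr_cancel (x y : R) : 0 <= y -> x ^+ 2 <= y ^+ 2 -> x <= y.
Proof.
move=> y0 h; rewrite leNgt; apply/negP => yx; have : y ^+ 2 < x ^+ 2 by nra.
by rewrite ltNge h.
Qed.

(** The midpoint inequality bounds the distance of two almost minimizers by
their excess over the infimum, so a minimizing sequence is Cauchy, and lower
semicontinuity passes to its limit. The cone condition on [q] supplies the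
lower semicontinuity of [phi + q]. *)
Lemma strongly_convex_min (phi : H -> \bar R) (q : H -> R) (c m : R) :
  convex_efun phi -> lower_semicontinuous phi -> proper_efun phi -> 0 < c ->
  (forall x, exists2 k, 0 <= k & forall y, q x - k * `|y - x| <= q y) ->
  (forall x y, q (2^-1 *: x + (1 - 2^-1) *: y) + c * `|x - y| ^+ 2 <= (q x + q y) / 2) ->
  (forall x, (m%:E <= phi x + (q x)%:E)%E) ->
  exists x, forall y, (phi x + (q x)%:E <= phi y + (q y)%:E)%E.
Proof.
move=> phiC phiL [phiN [z phiz]] c0 qL qC mlb.
pose F x := (phi x + (q x)%:E)%E.
(* The infimum is taken over the real upper bounds of values of [F], so that it
   is a real number although [F] may take the value [+oo]. *)
pose S := [set r | exists y, (F y <= r%:E)%E].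
have lbS : lbound S m.
  by move=> r [y yr]; rewrite -lee_fin (le_trans (mlb y)).
have hS : has_inf S.
  split; last by exists m.
  exists (fine (phi z) + q z), z.
  by rewrite EFinD fineK// fin_numE gt_eqF// lt_eqF.
pose i := inf S.
have Fi y : (i%:E <= F y)%E.
  have [E|] := boolP (F y \is a fin_num).
    rewrite -(fineK E) lee_fin; apply: ge_inf; first exact: hS.2.
    by exists y; rewrite fineK.
  by rewrite /F; have := phiN y; case: (phi y) => // _; rewrite addye// leey.
have mid x y a b : (F x <= a%:E)%E -> (F y <= b%:E)%E ->
    i + c * `|x - y| ^+ 2 <= (a + b) / 2.
  rewrite /F; move: (Fi (2^-1 *: x + (1 - 2^-1) *: y)) (qC x y).
  have := phiC x y 2^-1; rewrite /F.
  have := phiN (2^-1 *: x + (1 - 2^-1) *: y).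
  have := phiN x; have := phiN y.
  case: (phi x) => [px| |]//; case: (phi y) => [py| |]//;
    case: (phi _) => [pm| |]//; rewrite ?addye// -?EFinD ?lee_fin.
  - move=> _ _ _ /(_ ltac:(lra) ltac:(lra)).
    by move=> h1 h2 h3 h4 h5; lra.
  - by move=> _ _ _ /(_ ltac:(lra) ltac:(lra)).
(* The midpoint inequality turns the excess [c / (n + 1)^2] of the term of index
   [n] into a distance at most [1 / (n + 1)] from the later terms. *)
have eps0 (n : nat) : 0 < c * n.+1%:R^-1 ^+ 2 by rewrite mulr_gt0// exprn_gt0// invr_gt0.
have /choice[u uP] : forall n, exists y, (F y <= (i + c * n.+1%:R^-1 ^+ 2)%:E)%E.
  move=> n; have [r [y yr] ri] := inf_adherent (eps0 n) hS.
  by exists y; apply: le_trans yr _; rewrite lee_fin ltW.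
have invle (N n : nat) : (N <= n)%N -> n.+1%:R^-1 <= N.+1%:R^-1 :> R.
  by move=> Nn; rewrite lef_pV2 ?posrE// ler_nat.
have uC N n : (N <= n)%N -> `|u N - u n| <= N.+1%:R^-1.
  move=> Nn; apply: ler_sqr_cancel => //; rewrite -(ler_pM2l c0).
  have := mid _ _ _ _ (uP N) (uP n); have := invle _ _ Nn.
  have n0 : 0 <= n.+1%:R^-1 :> R by [].
  move: n0; move: (n.+1%:R^-1) (N.+1%:R^-1) => en eN n0 le; have : en ^+ 2 <= eN ^+ 2 :> R by nra.
  by move=> /(ler_wpM2l (ltW c0)); lra.
have [l ul] : exists l : H, u n @[n --> \oo] --> l.
  apply: cauchy_sequence_cvg => e e0.
  have [N _ /(_ _ (leqnn N)) Ne] := near_infty_natSinv_lt (PosNum e0).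
  by exists N => n /uC /le_lt_trans; apply.
exists l => y; apply: le_trans (Fi y); rewrite leNgt; apply/negP => il.
have [a ia al] : exists2 a, i < a & (a%:E < F l)%E.
  move: il; rewrite -/(F l); case: (F l) => [r| |]//.
    by rewrite lte_fin => ir; exists ((i + r) / 2); rewrite ?lte_fin; lra.
  by move=> _; exists (i + 1); rewrite ?ltry//; lra.
have [b bl ab] : exists2 b, (b%:E < phi l)%E & a < b + q l.
  move: al; rewrite /F; case: (phi l) (phiN l) => [r| |]//.
    rewrite -EFinD lte_fin => _ ir; exists ((r + a - q l) / 2); rewrite ?lte_fin; lra.
  by move=> _ _; exists (a - q l + 1); rewrite ?ltry//; lra.
have [k k0 qk] := qL l; have [W nW phiW] := phiL _ _ bl.
near \oo => n.
have := phiW (u n); have := uP n; rewrite /F.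
have h1 : W (u n) by near: n; exact: ul.
have h2 : `|u n - l| <= (b + q l - a) / (k + 1) / 2.
  near: n; apply: cvgr_distC_le ul _ _; rewrite !divr_gt0//; lra.
have h3 : c * n.+1%:R^-1 ^+ 2 < a - i.
  have : n.+1%:R^-1 < (a - i) / c.
    near: n; apply: (near_infty_natSinv_lt (PosNum (_ : 0 < (a - i) / c))).
    by apply: divr_gt0 => //; lra.
  rewrite ltr_pdivlMr// mulrC; apply: le_lt_trans; rewrite ler_pM2l// expr2.
  by rewrite ler_piMl// invf_le1// ler1n.
move: h3; set eps := c * _ => h3.
move=> h4 /(_ h1) h5; move: h4; have := qk (u n); move: h5.
case: (phi (u n)) => [r| |]//; rewrite -EFinD lee_fin lte_fin.
have : k * `|u n - l| <= (b + q l - a) / 2.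
  rewrite (le_trans (ler_wpM2l k0 h2))//.
  have : (b + q l - a) / (k + 1) * (k + 1) = b + q l - a by rewrite divfK// gt_eqF//; lra.
  have : 0 <= (b + q l - a) / (k + 1) by apply: divr_ge0; lra.
  by move: (_ / _) => Y; lra.
by move=> e1 e2 e3 e4; clear - e1 e2 e3 e4 h3 ab; lra.
Unshelve. all: by end_near. Qed.
End Minimization.

(** * Riesz representation, gradients and the resolvent *)

Lemma le0_of_small_multiples {R : realType} (a B : R) :
  (forall t, 0 < t -> t < 1 -> a <= t * B) -> a <= 0.
Proof.
move=> h; rewrite leNgt; apply/negP => a0.
have B0 : 0 < B by have := h (1 / 2) ltac:(lra) ltac:(lra); lra.
pose t := a / (a + 2 * B).
have e : t * (a + 2 * B) = a by rewrite /t divfK// gt_eqF//; lra.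
have t0 : 0 < t by rewrite /t divr_gt0//; lra.
have t1 : t < 1 by rewrite /t ltr_pdivrMr; lra.
by have := h t t0 t1; nra.
Qed.

Definition lipschitz_on_balls {R : realType} {H : completeNormedModType R} (g : H -> H) :=
  forall r, exists2 L, 0 <= L & forall x y, `|x| <= r -> `|y| <= r ->
    `|g x - g y| <= L * `|x - y|.

Definition subgradient_map {R : realType} {H : completeNormedModType R}
    (ip : {dot H for @idfun R}) (psi : H -> R) (g : H -> H) :=
  forall x y, psi x + ip (g x) (y - x) <= psi y.

Section Convex.
Context {R : realType} {H : completeNormedModType R} (ip : {dot H for @idfun R})
  (hH : hilbert_dot ip).

(** The representative is the minimizer of [|u|^2 / 2 - l u], whose derivative
[ip u - l] vanishes there. *)
Lemma riesz (l : {linear H -> R^o}) : continuous l ->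
  exists g, forall u, l u = ip g u.
Proof.
move=> /linear_bounded_continuous/linear_boundedP lb.
have [C C0 lC] : exists2 C, 0 < C & forall u, `|l u| <= C * `|u|.
  by near +oo_R => C; exists C; near: C => //; exact: nbhs_pinfty_gt.
pose q u : R := `|u| ^+ 2 / 2 - l u.
have lD u v : l (u + v) = (l u : R) + l v by rewrite (linearD l).
have lN u : l (- u) = - (l u : R) by rewrite (linearN l).
have lZ a u : l (a *: u) = a * (l u : R) by rewrite linearZ.
have qD u v : q v = q u + (ip u (v - u) - l (v - u)) + `|v - u| ^+ 2 / 2.
  by rewrite /q !hH !(ipDl, ipDr, ipNl, ipNr) lD lN (ipC ip v u); field.
have [||||u|u v|u|x xmin] := @strongly_convex_min R H (fun=> 0%E) q (1 / 8) (- C ^+ 2 / 2).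
- by move=> u v t t0 t1; rewrite !mule0 adde0.
- by move=> u a a0; exists setT => //; exact: filterT.
- by split=> [u|]; [exact: ltNyr|exists 0; exact: ltry].
- by lra.
- exists (`|u| + C); first by rewrite addr_ge0// ltW.
  move=> v; rewrite (qD u v).
  have := ip_ge hH u (v - u); have := ler_norm (l (v - u)); have := lC (v - u).
  by have := exprn_ge0 2 (normr_ge0 (v - u)); lra.
- rewrite /q !hH lD !lZ !(ipDl, ipDr, ipNl, ipNr, ipZl, ipZr) (ipC ip v u).
  by lra.
- rewrite add0e lee_fin /q; have := ler_norm (l u); have := lC u.
  by have := sqr_ge0 (`|u| - C); nra.
have key u : l u - ip x u <= 0.
  apply: (@le0_of_small_multiples _ _ (`|u| ^+ 2 / 2)) => t t0 t1.
  have := xmin (x + t *: u); rewrite !add0e lee_fin (qD x (x + t *: u)) (addrC x (t *: u)) addrK.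
  rewrite ipZr lZ normrZ exprMn real_normK ?num_real// => h.
  by rewrite -(ler_pM2l t0); lra.
exists x => u; have := key u; have := key (- u); rewrite ipNr lN.
by move=> h1 h2; lra.
Unshelve. all: by end_near. Qed.

Lemma gradientP (psi : H -> R) (z u : H) :
  differentiable psi z -> 'd psi z u = ip (gradient ip psi z) u.
Proof.
move=> psid.
have [g gP] := riesz (diff_continuous psid).
by rewrite /gradient; case: xgetP => [y -> //|/(_ g) []].
Qed.

(** By convexity the difference quotient from [x] towards [y] is at most the slope
[psi y - psi x] of the chord. *)
Lemma gradient_subgradient (psi : H -> R) :
  convex_function (setT : set (convex_lmodType H)) psi ->
  (forall z, differentiable psi z) ->
  subgradient_map ip psi (gradient ip psi).
Proof.
move=> psiC psid x y; rewrite -gradientP// -lerBrDl -deriveE//.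
have /cvg_ex[l lP] : derivable psi x (y - x) by exact: diff_derivable.
rewrite /derive (cvg_lim _ lP)//.
apply: (cvgr_to_le (cvg_dnbhs_at_right lP)).
near=> t.
have t0 : 0 < t by near: t; exact: nbhs_right_gt.
have t1 : t <= 1 by near: t; apply: nbhs_right_le.
have := psiC (Itv01 (ltW t0) t1) y x; rewrite !inE => /(_ I I).
rewrite convRE /= => psit.
rewrite /GRing.scale /= ler_pdivrMl//.
have -> : t *: (y - x) + x = t *: y + (1 - t) *: x.
  by apply: (ip_ext hH) => w; rewrite !(ipDl, ipNl, ipZl); ring.
by move: psit; rewrite /conv /= /unstable.onem; lra.
Unshelve. all: by end_near. Qed.

Lemma gradient_lipschitz_balls (psi : H -> R) :
  lipschitz_on_bounded_sets (gradient ip psi) -> lipschitz_on_balls (gradient ip psi).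
Proof.
move=> psiL r; have /psiL[M [_ lipM]] : bounded_set [set x : H | `|x| <= r].
  by exists r; split=> [|M rM x /= xr]; [exact: num_real|exact: le_trans xr (ltW rM)].
exists (`|M| + 1); first by rewrite addr_ge0.
move=> x y xr yr; apply: (lipM (`|M| + 1) _ (x, y)) => //.
by rewrite ltr_pwDr// ler_norm.
Qed.

End Convex.

Section Minty.
Context {R : realType} {H : completeNormedModType R} (ip : {dot H for @idfun R})
  (hH : hilbert_dot ip) (phi : H -> \bar R) (phi_convex : convex_efun phi)
  (phi_lsc : lower_semicontinuous phi) (phi_proper : proper_efun phi)
  (psi : H -> R) (g : H -> H)
  (g_sub : subgradient_map ip psi g)
  (g_lip : lipschitz_on_balls g).

Local Notation dphi := (subdifferential ip phi).

Lemma subdifferential_fin x v : dphi x v -> phi x \is a fin_num.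
Proof.
move=> /= xv; case: phi_proper => phiN [z phiz]; have := xv z.
case: (phi x) (phiN x) => // _; rewrite addye// leye_eq => /eqP phizy.
by rewrite phizy in phiz.
Qed.

Lemma subdifferential_fine x v y : dphi x v -> phi y \is a fin_num ->
  fine (phi x) + ip v (y - x) <= fine (phi y).
Proof.
move=> xv yfin; rewrite -lee_fin EFinD !fineK ?(subdifferential_fin xv)//; exact: xv.
Qed.

Lemma subdifferential_monotone x v y u :
  dphi x v -> dphi y u -> 0 <= ip (x - y) (v - u).
Proof.
move=> xv yu; have xf := subdifferential_fin xv; have yf := subdifferential_fin yu.
have := subdifferential_fine xv yf; have := subdifferential_fine yu xf.
rewrite !(ipDl, ipDr, ipNl, ipNr) (ipC ip y v) (ipC ip x u) (ipC ip y u) (ipC ip x v).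
by lra.
Qed.

(** The solution minimizes [phi + h psi + lam / 2 |.|^2 - ip w]. To see that
[- q' x] is then a subgradient of [phi], for the derivative [q'] of the smooth
part, compare the minimum with the values on the segment from [x] to [y] and
estimate the smooth part by its subgradient at the moving point: as [q'] is
Lipschitz near [x], the error is quadratic in the distance to [x]. *)
Lemma minty lam h w x0 v0 : 0 < lam -> 0 <= h -> dphi x0 v0 ->
  exists x, dphi x (w - lam *: x - h *: g x).
Proof.
move=> lam0 h0 v0P.
pose q u : R := h * psi u + lam / 2 * `|u| ^+ 2 - ip w u.
pose q' u : H := h *: g u + lam *: u - w.
have qsub u v : q u + ip (q' u) (v - u) + lam / 2 * `|v - u| ^+ 2 <= q v.
  have := ler_wpM2l h0 (g_sub u v); rewrite /q /q' !hH.
  rewrite !(ipDl, ipDr, ipNl, ipNr, ipZl, ipZr) (ipC ip v u); lra.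
have v0f := subdifferential_fin v0P.
pose K := `|v0 + q' x0|.
have [||||u|u v|u|x xmin] := @strongly_convex_min R H phi q (lam / 8)
  (fine (phi x0) + q x0 - K ^+ 2 / (2 * lam)) => //.
- by rewrite divr_gt0.
- exists `|q' u| => // v; apply: le_trans (qsub u v).
  have := ip_ge hH (q' u) (v - u).
  by have := mulr_ge0 (ltW lam0) (exprn_ge0 2 (normr_ge0 (v - u))); lra.
- set m := 2^-1 *: u + (1 - 2^-1) *: v.
  have := qsub m u; have := qsub m v.
  have -> : v - m = - 2^-1 *: (u - v).
    by apply: (ip_ext hH) => z; rewrite !(ipDl, ipNl, ipZl); field.
  have -> : u - m = 2^-1 *: (u - v).
    by apply: (ip_ext hH) => z; rewrite !(ipDl, ipNl, ipZl); field.
  by rewrite !hH !(ipZr, ipZl); lra.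
- apply: (@le_trans _ _ (phi x0 + (ip v0 (u - x0))%:E + (q u)%:E)%E); last first.
    by rewrite leeD2r.
  rewrite -(fineK v0f) -!EFinD lee_fin.
  have := qsub x0 u; have := ip_ge hH (v0 + q' x0) (u - x0); rewrite -/K ipDl.
  have : 0 <= (`|u - x0| * lam - K) ^+ 2 / (2 * lam) by rewrite divr_ge0 ?sqr_ge0//; lra.
  have -> : (`|u - x0| * lam - K) ^+ 2 / (2 * lam) =
    lam / 2 * `|u - x0| ^+ 2 - K * `|u - x0| + K ^+ 2 / (2 * lam).
    by field; rewrite gt_eqF.
  by lra.
have xf : phi x \is a fin_num.
  have := xmin x0; rewrite -(fineK v0f); case: phi_proper => /(_ x) + _.
  by case: (phi x).
exists x => y; have -> : w - lam *: x - h *: g x = - q' x.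
  by apply: (ip_ext hH) => z; rewrite !(ipDl, ipNl, ipZl); ring.
have [yf|] := boolP (phi y \is a fin_num); last first.
  by case: phi_proper => /(_ y) + _; case: (phi y) => // _ _; exact: leey.
rewrite -(fineK xf) -(fineK yf) -EFinD lee_fin -subr_le0.
have [L L0 gL] := g_lip (`|x| + `|y|).
apply: (@le0_of_small_multiples _ _ ((h * L + lam) * `|y - x| ^+ 2)) => t t0 t1.
pose z := t *: y + (1 - t) *: x.
have phiz : fine (phi z) <= t * fine (phi y) + (1 - t) * fine (phi x) /\ phi z \is a fin_num.
  have := phi_convex y x t0 t1; rewrite -/z -(fineK yf) -(fineK xf) -!EFinM -EFinD.
  by case: phi_proper => /(_ z) + _; case: (phi z).
case: phiz => phiz zf.
have := xmin z; rewrite -(fineK zf) -{1}(fineK xf) -!EFinD lee_fin.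
have := qsub z x.
have -> : x - z = - t *: (y - x).
  by apply: (ip_ext hH) => u; rewrite !(ipDl, ipNl, ipZl); ring.
have zn : `|z| <= `|x| + `|y|.
  rewrite (le_trans (ler_normD _ _))// !normrZ !gtr0_norm ?subr_gt0//.
  by have := normr_ge0 x; have := normr_ge0 y; nra.
have q'z : `|q' z - q' x| <= t * (h * L + lam) * `|y - x|.
  have -> : q' z - q' x = h *: (g z - g x) + lam *: (z - x).
    by apply: (ip_ext hH) => u; rewrite !(ipDl, ipNl, ipZl); ring.
  rewrite (le_trans (ler_normD _ _))// !normrZ !ger0_norm ?(ltW lam0)//.
  have := gL z x zn ltac:(by rewrite lerDl).
  have -> : z - x = t *: (y - x).
    by apply: (ip_ext hH) => u; rewrite !(ipDl, ipNl, ipZl); ring.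
  by rewrite normrZ gtr0_norm// => /(ler_wpM2l h0); lra.
have := ip_le hH (q' z - q' x) (y - x).
have := ler_wpM2r (normr_ge0 (y - x)) q'z.
have : 0 <= lam / 2 * `|- t *: (y - x)| ^+ 2 by rewrite mulr_ge0// divr_ge0// ltW.
rewrite !ipZr ipDl !ipNl => e1 e2 e3 e4 e5.
rewrite -(ler_pM2l t0).
move: e1 e2 e3 e4 e5; move: (ip (q' z) _) (ip (q' x) _) => a b e1 e2 e3 e4 e5.
have e6 : t * (a - b) <= t * (t * (h * L + lam) * `|y - x| * `|y - x|).
  by rewrite ler_pM2l//; lra.
by lra.
Qed.

End Minty.

(** * Discrete stability *)

Section Discrete.
Context {R : realType} {H : completeNormedModType R} (ip : {dot H for @idfun R})
  (hH : hilbert_dot ip) (phi : H -> \bar R) (phi_proper : proper_efun phi) (g : H -> H).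

Local Notation dphi := (subdifferential ip phi).

(** The defect in the equation over a time step [h] from [(x, v)] to [(x', v')]
when the coefficient [l], [v] and [g x] are frozen at their initial values. *)
Definition residual (l h : R) (x v x' v' : H) : H :=
  l *: (x' - x) + (v' - v) + h *: (v + g x).

(** The quantity [W k = |l k (x k - y k) + (v k - u k)|] bounds [m |x k - y k|] and
[|v k - u k|]. One step of the equation multiplies it by at most
[1 + h (1 + L / m)] and adds the two residuals; passing from the coefficient
[l k] to [l k.+1] multiplies it by at most [1 + a k / m]. *)
Lemma discrete_stability N (l a rho : nat -> R) (h m L : R) (x v y u : nat -> H) :
  0 < m -> 0 <= h -> 0 <= L ->
  (forall k, (k <= N)%N -> m <= l k) ->
  (forall k, (k < N)%N -> `|l k.+1 - l k| <= a k) ->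
  (forall k, (k <= N)%N -> dphi (x k) (v k)) ->
  (forall k, (k <= N)%N -> dphi (y k) (u k)) ->
  (forall k, (k <= N)%N -> `|g (x k) - g (y k)| <= L * `|x k - y k|) ->
  (forall k, (k < N)%N -> `|residual (l k) h (x k) (v k) (x k.+1) (v k.+1)| <= rho k) ->
  (forall k, (k < N)%N -> `|residual (l k) h (y k) (u k) (y k.+1) (u k.+1)| <= rho k) ->
  x 0 = y 0 -> v 0 = u 0 ->
  forall B, B = expR (\sum_(k < N) (a k / m + h * (1 + L / m))) * \sum_(k < N) (2 * rho k) ->
  m * `|x N - y N| <= B /\ `|v N - u N| <= B.
Proof.
move=> m0 h0 L0 lm la xv yu gL xr yr xy0 vu0 B ->.
pose W k := `|l k *: (x k - y k) + (v k - u k)|.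
have mon k : (k <= N)%N -> 0 <= ip (x k - y k) (v k - u k).
  by move=> kN; exact: subdifferential_monotone (xv _ kN) (yu _ kN).
have mW k c : (k <= N)%N -> m <= c ->
    m * `|x k - y k| <= `|c *: (x k - y k) + (v k - u k)| /\
    `|v k - u k| <= `|c *: (x k - y k) + (v k - u k)|.
  move=> kN mc; have c0 : 0 <= c by rewrite (le_trans (ltW m0)).
  split; last exact: (monotone_normr hH c0 (mon k kN)).
  apply: le_trans (monotone_norml hH c0 (mon k kN)).
  by rewrite ler_wpM2r.
suff WN k : (k <= N)%N ->
    W k <= expR (\sum_(i < k) (a i / m + h * (1 + L / m))) * \sum_(i < k) (2 * rho i).
  have [h1 h2] := mW N (l N) (leqnn N) (lm N (leqnn N)).
  by split; [exact: le_trans h1 (WN _ (leqnn N))|exact: le_trans h2 (WN _ (leqnn N))].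
elim: k => [|k IH] kN.
  by rewrite !big_ord0 mulr0 /W xy0 vu0 !subrr scaler0 addr0 normr0.
rewrite !big_ord_recr/=; set S := \sum_(i < k) (_ + _) in IH *.
set P := \sum_(i < k) _ in IH *.
have {}IH := IH (ltnW kN).
set X := x k.+1 - y k.+1; set Z := `|l k *: X + (v k.+1 - u k.+1)|.
have [mX _] := mW k.+1 (l k) kN (lm k (ltnW kN)).
rewrite -/X -/Z in mX.
have a0 : 0 <= a k by apply: le_trans (la k kN).
have Wk1 : W k.+1 <= (1 + a k / m) * Z.
  have -> : W k.+1 = `|l k *: X + (v k.+1 - u k.+1) + (l k.+1 - l k) *: X|.
    by rewrite /W; congr (`|_|); apply: (ip_ext hH) => w; rewrite !(ipDl, ipNl, ipZl); ring.
  rewrite (le_trans (ler_normD _ _))// mulrDl mul1r lerD2l normrZ.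
  rewrite (le_trans (ler_wpM2r _ (la k kN)))// -mulrA ler_wpM2l// mulrC ler_pdivlMr//.
  by rewrite mulrC.
have [mXk Vk] := mW k (l k) (ltnW kN) (lm k (ltnW kN)).
rewrite -/(W k) in mXk Vk.
have Zle : Z <= (1 + h * (1 + L / m)) * W k + 2 * rho k.
  have -> : Z = `|(l k *: (x k - y k) + (v k - u k))
      + (residual (l k) h (x k) (v k) (x k.+1) (v k.+1) -
         residual (l k) h (y k) (u k) (y k.+1) (u k.+1))
      - h *: ((v k - u k) + (g (x k) - g (y k)))|.
    rewrite /Z /X /residual; congr (`|_|); apply: (ip_ext hH) => w.
    by rewrite !(ipDl, ipNl, ipZl); ring.
  rewrite (le_trans (ler_normB _ _))// (le_trans (lerD (ler_normD _ _) (lexx _)))//.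
  rewrite -/(W k) normrZ (ger0_norm h0).
  have := ler_normB (residual (l k) h (x k) (v k) (x k.+1) (v k.+1))
    (residual (l k) h (y k) (u k) (y k.+1) (u k.+1)).
  have := xr k kN; have := yr k kN.
  have : h * `|v k - u k + (g (x k) - g (y k))| <= h * ((1 + L / m) * W k).
    rewrite ler_wpM2l// (le_trans (ler_normD _ _))// mulrDl mul1r lerD//.
    rewrite (le_trans (gL k (ltnW kN)))// -mulrA ler_wpM2l// mulrC ler_pdivlMr//.
    by rewrite mulrC.
  by lra.
have W0 : 0 <= W k by exact: normr_ge0.
have r0 : 0 <= rho k by apply: le_trans (xr k kN).
have S0 : 1 <= expR S.
  apply: le_trans (expR_ge1Dx S); rewrite lerDl sumr_ge0// => i _.
  by rewrite addr_ge0// ?divr_ge0 ?mulr_ge0 ?addr_ge0 ?divr_ge0 ?(ltW m0)//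
     (le_trans _ (la i (leq_trans (ltn_ord i) (ltnW kN)))).
have hK : 0 <= h * (1 + L / m) by rewrite mulr_ge0// addr_ge0// divr_ge0// ltW.
have am : 0 <= a k / m by rewrite divr_ge0// ltW.
rewrite (le_trans Wk1)// expRD expRD.
apply: (@le_trans _ _ (expR (a k / m) * (expR (h * (1 + L / m)) * (expR S * (P + 2 * rho k))))).
  apply: ler_pM; [by rewrite addr_ge0|exact: normr_ge0|exact: expR_ge1Dx|].
  apply: (le_trans Zle).
  apply: (@le_trans _ _ ((1 + h * (1 + L / m)) * (W k + 2 * rho k))).
    by have := mulr_ge0 hK r0; lra.
  apply: ler_pM; [by rewrite addr_ge0|by rewrite addr_ge0 ?mulr_ge0|exact: expR_ge1Dx|].
  by have : rho k <= expR S * rho k; [rewrite ler_peMl | lra].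
by rewrite le_eqVlt; apply/orP; left; apply/eqP; ring.
Qed.

End Discrete.

(** * The semi-implicit Euler scheme *)

Section Euler.
Context {R : realType} {H : completeNormedModType R} (ip : {dot H for @idfun R})
  (hH : hilbert_dot ip) (phi : H -> \bar R) (phi_convex : convex_efun phi)
  (phi_lsc : lower_semicontinuous phi) (phi_proper : proper_efun phi)
  (psi : H -> R) (g : H -> H)
  (g_sub : subgradient_map ip psi g)
  (g_lip : lipschitz_on_balls g)
  (E_min : R) (E_lb : forall z, (E_min%:E <= phi z + (psi z)%:E)%E)
  (lam V : R -> R)
  (lamV : forall s t, 0 <= s -> s <= t -> `|lam t - lam s| <= V t - V s)
  (lam_min : forall T, 0 < T ->
    exists2 m, 0 < m & forall t, 0 <= t -> t <= T -> m <= lam t)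
  (x0 v0 : H) (v0_sub : subdifferential ip phi x0 v0).

Local Notation dphi := (subdifferential ip phi).

(** The step is explicit in [v] and implicit in [g]: being implicit in [g] makes
[phi + psi] decrease along the scheme for every step [h <= 1], without
restriction by the local Lipschitz constants of [g]. *)
Definition euler_step (l h : R) (p p' : H * H) :=
  l *: (p'.1 - p.1) + (p'.2 - p.2) + h *: (p.2 + g p'.1) = 0.

Definition euler_sequence (h : R) (p : nat -> H * H) :=
  [/\ p 0 = (x0, v0), forall k, dphi (p k).1 (p k).2 &
      forall k, euler_step (lam (k%:R * h)) h (p k) (p k.+1)].

Lemma lam_gt0 t : 0 <= t -> 0 < lam t.
Proof.
move=> t0; have [m m0 mP] := lam_min (ltr_pwDr ltr01 t0).
by rewrite (lt_le_trans m0)// mP// lerDl.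
Qed.

Lemma euler_sequence_exists h : 0 <= h -> exists p, euler_sequence h p.
Proof.
move=> h0.
have /choice[f fP] : forall q : nat * (H * H), exists p' : H * H,
    dphi q.2.1 q.2.2 ->
    dphi p'.1 p'.2 /\ euler_step (lam (q.1%:R * h)) h q.2 p'.
  move=> [k [x v]] /=.
  have [|xv] := boolP `[< dphi x v >]; last first.
    by exists (0, 0) => xv'; case/asboolP: xv.
  move=> /asboolP xv; set l := lam _.
  have l0 : 0 < l by apply: lam_gt0; rewrite mulr_ge0.
  have [x' x'P] := minty hH phi_convex phi_lsc phi_proper g_sub g_lip
    (l *: x + v - h *: v) l0 h0 v0_sub.
  exists (x', l *: x + v - h *: v - l *: x' - h *: g x') => _; split => //.
  rewrite /euler_step/=; apply: (ip_ext hH) => w.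
  by rewrite !(ipDl, ipNl, ipZl) ip0l; ring.
pose p := fix p k := if k is k'.+1 then f (k', p k') else (x0, v0).
have pP k : dphi (p k).1 (p k).2.
  by elim: k => [//|k IH] /=; have [] := fP (k, p k) IH.
by exists p; split => // k; have [] := fP (k, p k) (pP k).
Qed.

Let E z := fine (phi z) + psi z.

Lemma energy_lb x v : dphi x v -> E_min <= E x.
Proof.
move=> /(subdifferential_fin phi_proper) xf.
by have := E_lb x; rewrite -(fineK xf) -EFinD lee_fin.
Qed.

(** Pair the step with [x' - x]: the term in [v' - v] is nonnegative by
monotonicity, and [v'], [g x'] are subgradients of [phi] and [psi] at [x']. *)
Lemma euler_energy l h x v x' v' : 0 <= h -> h <= 1 ->
  dphi x v -> dphi x' v' -> euler_step l h (x, v) (x', v') ->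
  l * `|x' - x| ^+ 2 <= h * (E x - E x').
Proof.
move=> h0 h1 xv xv' /(congr1 (fun z => ip z (x' - x))).
rewrite /= ip0l hH.
have := g_sub x' x.
have := subdifferential_fine phi_proper xv' (subdifferential_fin phi_proper xv).
have := subdifferential_monotone phi_proper xv' xv.
have -> : x - x' = - (x' - x) by rewrite opprB.
move: (x' - x) => d; rewrite !ipNr (ipC ip d) !(ipDl, ipZl, ipNl).
rewrite /E; move: (ip v' _) (ip v _) (ip (g x') _) (ip d d) => a b c D.
move=> m1 m2 m3 e.
have e1 : h * (fine (phi x') + psi x' - (fine (phi x) + psi x)) <= h * (a + c).
  by rewrite ler_wpM2l//; lra.
have e2 : 0 <= (1 - h) * (a - b) by rewrite mulr_ge0// subr_ge0// -subr_ge0.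
by lra.
Qed.

(** One induction step of the Cauchy-Schwarz estimate of the square of the length
of a path of [k] steps by [k] times the sum of the squares of its steps. *)
Lemma sqr_path_bound (p d S s : R) (k : nat) :
  p ^+ 2 <= k%:R * S -> d ^+ 2 <= s -> (k = 0 -> p = 0) -> 0 <= S ->
  (p + d) ^+ 2 <= k.+1%:R * (S + s).
Proof.
move=> pS ds p0 S0; case: k pS p0 => [|k] pS p0; first by rewrite (p0 erefl); nra.
rewrite -natr1; move: pS; have : 0 < k.+1%:R :> R by [].
move: (k.+1%:R) => c c0 pS.
(* [c (p + d)^2 <= (c + 1) (p^2 + c d^2)] since the difference is [(p - c d)^2]. *)
have : 0 <= (p - c * d) ^+ 2 by rewrite sqr_ge0.
have : (c + 1) * (c * d ^+ 2) <= (c + 1) * (c * s) by rewrite ler_wpM2l ?ler_wpM2l//; lra.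
have : (c + 1) * p ^+ 2 <= (c + 1) * (c * S) by rewrite ler_wpM2l//; lra.
by move=> *; rewrite -(ler_pM2l c0); lra.
Qed.

Lemma euler_path_bound m h p N : 0 < m -> 0 < h -> h <= 1 -> euler_sequence h p ->
  (forall k, (k < N)%N -> m <= lam (k%:R * h)) ->
  `|(p N).1 - x0| ^+ 2 <= N%:R * (h / m * (E x0 - E (p N).1)) /\ E (p N).1 <= E x0.
Proof.
move=> m0 hp h1 [p0 pP pE]; have h0 := ltW hp; elim: N => [_|N IH mN].
  by rewrite p0 subrr normr0 mul0r expr0n.
have [IH1 IH2] := IH (fun k kN => mN k (ltnW kN)).
have := pE N; have := pP N; have := pP N.+1.
move: (p N) (p N.+1) IH1 IH2 => [x v] [x' v'] /= IH1 IH2 xv' xv st.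
have mlam := mN _ (ltnSn N).
have en := euler_energy h0 h1 xv xv' st.
have en' : m * `|x' - x| ^+ 2 <= h * (E x - E x').
  by rewrite (le_trans _ en)// ler_wpM2r// exprn_ge0.
have d2 : `|x' - x| ^+ 2 <= h / m * (E x - E x').
  by rewrite mulrAC ler_pdivlMr// mulrC.
have Ed : E x' <= E x.
  by rewrite -subr_ge0 -(pmulr_rge0 _ hp) (le_trans _ en')// mulr_ge0 ?exprn_ge0// ltW.
split; last by rewrite (le_trans Ed).
have -> : E x0 - E x' = (E x0 - E x) + (E x - E x') by ring.
rewrite mulrDr; apply: le_trans (@sqr_path_bound `|x - x0| _ _ _ N _ d2 _ _).
- rewrite lerXn2r ?nnegrE ?addr_ge0//.
  by rewrite [leRHS]addrC (le_trans _ (ler_normD _ _))// addrA subrK.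
- exact: IH1.
- move=> N0; move: IH1; rewrite N0 mul0r => le0; apply/eqP.
  by rewrite -sqrf_eq0 eq_le le0 sqr_ge0.
- by rewrite mulr_ge0 ?subr_ge0// divr_ge0// ltW.
Qed.

Lemma V_le s t : 0 <= s -> s <= t -> V s <= V t.
Proof. by move=> s0 st; rewrite -subr_ge0 (le_trans _ (lamV s0 st)). Qed.

Lemma telescoping_bound (u : nat -> H) c k n :
  (forall i, (i < k + n)%N -> `|u i.+1 - u i| <= c) -> `|u (k + n)%N - u k| <= n%:R * c.
Proof.
elim: n => [|n IH] uc; first by rewrite addn0 subrr normr0 mul0r.
rewrite addnS -natr1 mulrDl mul1r [leRHS]addrC.
rewrite -[u (k + n).+1](subrK (u (k + n)%N)) -addrA (le_trans (ler_normD _ _))//.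
rewrite lerD//; first by apply: uc; rewrite addnS.
by apply: IH => i ik; apply: uc; rewrite addnS ltnW.
Qed.

(** By monotonicity the norm of [lam dx + dv], which the scheme prescribes, bounds
[lam |dx|] and [|dv|]; the bound on [v] is the resulting Gronwall estimate. *)
Lemma euler_velocity_bound G h N (p : nat -> H * H) : 0 <= G -> 0 <= h -> h <= 1 ->
  euler_sequence h p ->
  (forall k, (k <= N)%N -> `|g (p k).1| <= G) ->
  `|(p N).2| + G <= expR (N%:R * h) * (`|v0| + G) /\
  forall k, (k < N)%N ->
    `|(p k.+1).2 - (p k).2| <= h * (`|(p k).2| + G) /\
    lam (k%:R * h) * `|(p k.+1).1 - (p k).1| <= h * (`|(p k).2| + G).
Proof.
move=> G0 h0 h1 [p0 pP pE] gG.
have step k : (k < N)%N ->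
    `|(p k.+1).2 - (p k).2| <= h * (`|(p k).2| + G) /\
    lam (k%:R * h) * `|(p k.+1).1 - (p k).1| <= h * (`|(p k).2| + G).
  move=> kN.
  have l0 : 0 <= lam (k%:R * h) by rewrite ltW// lam_gt0// mulr_ge0.
  have mon := subdifferential_monotone phi_proper (pP k.+1) (pP k).
  have e : lam (k%:R * h) *: ((p k.+1).1 - (p k).1) + ((p k.+1).2 - (p k).2) =
      - (h *: ((p k).2 + g (p k.+1).1)).
    by apply/eqP; rewrite -subr_eq0 opprK; apply/eqP; exact: pE.
  have hle : `|- (h *: ((p k).2 + g (p k.+1).1))| <= h * (`|(p k).2| + G).
    rewrite normrN normrZ (ger0_norm h0) ler_wpM2l// (le_trans (ler_normD _ _))//.
    by rewrite lerD2l gG.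
  split; rewrite (le_trans _ hle)// -e.
    exact: (monotone_normr hH).
  exact: (monotone_norml hH).
split => //; elim: N gG step => [_ _|N IH gG step].
  by rewrite p0 mul0r expR0 mul1r.
have {}IH := IH (fun k kN => gG k (leqW kN)) (fun k kN => step k (ltnW kN)).
have [vle _] := step N (ltnSn N).
rewrite -natr1 mulrDl mul1r expRD [X in X * (_ + G)]mulrC -mulrA.
have vN : `|(p N.+1).2| <= `|(p N).2| + `|(p N.+1).2 - (p N).2|.
  by rewrite (le_trans _ (ler_normD _ _))// addrC subrK.
apply: (@le_trans _ _ ((1 + h) * (`|(p N).2| + G))); first by lra.
apply: ler_pM => //; [lra|by rewrite addr_ge0|].
exact: expR_ge1Dx.
Qed.

(** Bounds up to time [T] with a constant that does not depend on the step. The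
last one concerns [n] consecutive steps with the coefficient frozen at the
first one: this is the form that survives the limit [h -> 0]. *)
Definition euler_bounds T C := forall h p, 0 < h -> h <= 1 -> euler_sequence h p ->
  forall i n, (i + n)%:R * h <= T ->
  [/\ `|(p i).1| <= C, `|(p i).2| <= C,
     `|(p (i + n)%N).1 - (p i).1| <= C * (n%:R * h),
     `|(p (i + n)%N).2 - (p i).2| <= C * (n%:R * h) &
     `|residual g (lam (i%:R * h)) (n%:R * h) (p i).1 (p i).2
          (p (i + n)%N).1 (p (i + n)%N).2|
       <= C * (n%:R * h) * (V ((i + n)%:R * h) - V (i%:R * h) + n%:R * h)].

Lemma g_bounded r : exists2 G, 0 <= G & forall x, `|x| <= r -> `|g x| <= G.
Proof.
have [L L0 gL] := g_lip `|r|.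
exists (`|g 0| + L * `|r|) => [|x xr]; first by rewrite addr_ge0 ?mulr_ge0.
have xr' : `|x| <= `|r| by rewrite (le_trans xr) ?ler_norm.
rewrite -[g x](subrK (g 0)) addrC (le_trans (ler_normD _ _))// lerD2l.
rewrite (le_trans (gL x 0 xr' _)) ?normr0// subr0 ler_wpM2l//.
Qed.

Lemma grid_le (h T : R) (k n : nat) : 0 < h -> n%:R * h <= T -> (k <= n)%N -> k%:R * h <= T.
Proof. by move=> h0 nT kn; rewrite (le_trans _ nT)// ler_wpM2r ?ler_nat// ltW. Qed.

(** The decrease of the energy bounds the positions, hence the gradients, hence
[v] and the speeds. Each of the [n] steps then contributes to the defect the
change of [lam], [v] and [g x] since the first step, times a constant times [h]. *)
Lemma euler_bounds_exist T : 0 < T -> exists2 C, 0 <= C & euler_bounds T C.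
Proof.
move=> T0; have [m m0 mlam] := lam_min T0.
have Emin : E_min <= E x0 by exact: energy_lb v0_sub.
pose r := Num.sqrt (T / m * (E x0 - E_min)).
have r20 : 0 <= T / m * (E x0 - E_min).
  by rewrite mulr_ge0 ?subr_ge0// divr_ge0// ltW.
have [G G0 gG] := g_bounded (`|x0| + r).
pose C2 := expR T * (`|v0| + G).
have C20 : 0 <= C2 by rewrite mulr_ge0 ?expR_ge0// addr_ge0.
pose C1 := `|x0| + r + C2 + C2 / m.
have r0 : 0 <= r by exact: sqrtr_ge0.
have C2m : 0 <= C2 / m by rewrite divr_ge0// ltW.
have C10 : 0 <= C1 by rewrite !addr_ge0.
have [L L0 gL] := g_lip C1.
exists (C1 + C1 * (2 + L)); first by rewrite addr_ge0 ?mulr_ge0 ?addr_ge0.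
move=> h p h0 h1 pe; have [_ pP _] := pe.
have lamk k : k%:R * h <= T -> m <= lam (k%:R * h).
  by move=> kT; apply: mlam => //; rewrite mulr_ge0// ltW.
have xb k : k%:R * h <= T -> `|(p k).1| <= `|x0| + r.
  move=> kT; have [|] := euler_path_bound m0 h0 h1 pe (N := k).
    by move=> j /ltnW jk; apply: lamk; exact: grid_le kT jk.
  move=> xk Ek; rewrite -[(p k).1](subrK x0) addrC (le_trans (ler_normD _ _))// lerD2l.
  apply: ler_sqr_cancel => //; rewrite sqr_sqrtr// (le_trans xk)//.
  have := energy_lb (pP k); move: (E (p k).1) Ek {xk} => Ek Ekx Ek0.
  have -> : k%:R * (h / m * (E x0 - Ek)) = k%:R * h * ((E x0 - Ek) / m).
    by move: (k%:R); move=> ?; ring.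
  have -> : T / m * (E x0 - E_min) = T * ((E x0 - E_min) / m) by ring.
  apply: ler_pM => //; first exact: mulr_ge0 (ler0n _ _) (ltW h0).
    by rewrite mulr_ge0 ?invr_ge0 ?subr_ge0// ltW.
  by rewrite ler_pM2r ?invr_gt0//; lra.
have vG k : k%:R * h <= T -> `|(p k).2| + G <= C2.
  move=> kT; have [|v1 _] := euler_velocity_bound (N := k) G0 (ltW h0) h1 pe.
    by move=> j jk; apply: gG; apply: xb; exact: grid_le kT jk.
  by rewrite (le_trans v1)// ler_wpM2r ?addr_ge0// ler_expR.
have stepb k : k.+1%:R * h <= T ->
    `|(p k.+1).2 - (p k).2| <= C1 * h /\ `|(p k.+1).1 - (p k).1| <= C1 * h.
  move=> kT; have [|_ /(_ k (ltnSn k)) [v2 v3]] :=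
    euler_velocity_bound (N := k.+1) G0 (ltW h0) h1 pe.
    by move=> j jk; apply: gG; apply: xb; exact: grid_le kT jk.
  have kT' := grid_le h0 kT (leqnSn k).
  have hC : h * (`|(p k).2| + G) <= h * C2 by rewrite ler_wpM2l ?(ltW h0)// vG.
  have x0r : 0 <= `|x0| + r by rewrite addr_ge0.
  split.
    rewrite (le_trans v2)// (le_trans hC)// mulrC ler_wpM2r ?(ltW h0)//.
    by rewrite /C1; lra.
  apply: (@le_trans _ _ (C2 / m * h)); last by rewrite ler_wpM2r ?(ltW h0)// /C1; lra.
  rewrite mulrAC ler_pdivlMr// mulrC [C2 * h]mulrC (le_trans _ hC)// (le_trans _ v3)//.
  by rewrite ler_wpM2r// lamk.
move=> i n inT.
have nb n' : (n' <= n)%N -> (i + n')%:R * h <= T.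
  by move=> n'n; apply: (grid_le h0 inT); rewrite leq_add2l.
have xs n' : (n' <= n)%N -> `|(p (i + n')%N).1 - (p i).1| <= n'%:R * (C1 * h).
  move=> n'n; apply: (telescoping_bound (u := fun j => (p j).1)) => j jn.
  by have [] := stepb j (grid_le h0 (nb _ n'n) jn).
have vs n' : (n' <= n)%N -> `|(p (i + n')%N).2 - (p i).2| <= n'%:R * (C1 * h).
  move=> n'n; apply: (telescoping_bound (u := fun j => (p j).2)) => j jn.
  by have [] := stepb j (grid_le h0 (nb _ n'n) jn).
have CC : C1 <= C1 + C1 * (2 + L) by rewrite lerDl mulr_ge0// addr_ge0.
have iT : i%:R * h <= T by rewrite -[i]addn0 nb.
have nh : 0 <= n%:R * h by rewrite mulr_ge0// ltW.
have x0r : 0 <= `|x0| + r by rewrite addr_ge0.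
have xC k : k%:R * h <= T -> `|(p k).1| <= C1.
  by move=> /xb; rewrite /C1; lra.
split.
- exact: le_trans (xC _ iT) CC.
- by rewrite (le_trans _ CC)//; have := vG i iT; rewrite /C1; lra.
- by rewrite (le_trans (xs n _))// mulrCA ler_wpM2r.
- by rewrite (le_trans (vs n _))// mulrCA ler_wpM2r.
have Vle n1 n2 : (n1 <= n2)%N -> V ((i + n1)%:R * h) <= V ((i + n2)%:R * h).
  move=> n12; apply: V_le; first by rewrite mulr_ge0// ltW.
  by rewrite ler_wpM2r ?(ltW h0)// ler_nat leq_add2l.
have V0 n' : 0 <= V ((i + n')%:R * h) - V (i%:R * h).
  by rewrite subr_ge0 -{1}[i]addn0 Vle.
suff res n' : (n' <= n)%N ->
    `|residual g (lam (i%:R * h)) (n'%:R * h) (p i).1 (p i).2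
          (p (i + n')%N).1 (p (i + n')%N).2|
       <= C1 * (2 + L) * (n'%:R * h) * (V ((i + n')%:R * h) - V (i%:R * h) + n'%:R * h).
  apply: (le_trans (res n _)) => //; apply: ler_wpM2r; first exact: addr_ge0.
  by apply: ler_wpM2r => //; rewrite lerDr.
elim: n' => [|n' IH] n'n.
  rewrite /residual addn0 !subrr mul0r !scaler0 scale0r !addr0 normr0.
  by rewrite ?(mulr0, mul0r).
have {}IH := IH (ltnW n'n).
set k := (i + n')%N in IH *; rewrite addnS -/k.
have kT : k.+1%:R * h <= T by rewrite /k -addnS nb.
have pEk : euler_step (lam (k%:R * h)) h (p k) (p k.+1) by case: pe.
set l := lam (i%:R * h).
have -> : residual g l (n'.+1%:R * h) (p i).1 (p i).2 (p k.+1).1 (p k.+1).2 =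
    residual g l (n'%:R * h) (p i).1 (p i).2 (p k).1 (p k).2 +
    (- (lam (k%:R * h) - l) *: ((p k.+1).1 - (p k).1) - h *: ((p k).2 - (p i).2)
     - h *: (g (p k.+1).1 - g (p i).1)).
  apply: (ip_ext hH) => w; have := congr1 (fun z => ip z w) pEk.
  rewrite /residual ip0l !(ipDl, ipZl, ipNl) -natr1.
  by move: (n'%:R) (h) => ? ?; lra.
have [dv dx] := stepb k kT.
have i0 : 0 <= i%:R * h by rewrite mulr_ge0// ltW.
have ik : i%:R * h <= k%:R * h by rewrite ler_pM2r// ler_nat leq_addr.
have t1 : `|- (lam (k%:R * h) - l) *: ((p k.+1).1 - (p k).1)|
    <= (V (k.+1%:R * h) - V (i%:R * h)) * (C1 * h).
  rewrite normrZ normrN; apply: ler_pM => //.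
  by rewrite (le_trans (lamV i0 ik))// lerD2r /k -addnS Vle.
have t2 : `|h *: ((p k).2 - (p i).2)| <= h * (n'%:R * (C1 * h)).
  by rewrite normrZ (gtr0_norm h0) ler_wpM2l ?(ltW h0)// vs// ltnW.
have t3 : `|h *: (g (p k.+1).1 - g (p i).1)| <= h * (L * (n'.+1%:R * (C1 * h))).
  rewrite normrZ (gtr0_norm h0) ler_wpM2l ?(ltW h0)//.
  rewrite (le_trans (gL _ _ (xC _ kT) (xC _ iT)))// ler_wpM2l//.
  by rewrite /k -addnS; apply: xs.
apply: le_trans (ler_normD _ _) _; apply: le_trans (lerD IH (ler_normB _ _)) _.
have := ler_normB (- (lam (k%:R * h) - l) *: ((p k.+1).1 - (p k).1))
  (h *: ((p k).2 - (p i).2)).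
have Vk : V (k%:R * h) <= V (k.+1%:R * h) by rewrite /k -addnS Vle.
have nn : 0 <= n'%:R :> R by [].
move: t1 t2 t3 Vk (V0 n') nn; rewrite -!(natr1 n').
move: (`|_ - _|) (`|_ *: _|) (`|_ *: _|) (`|_ *: _|) => A B D F.
move: (V _) (V _) (V _) (n'%:R) => a b c d t1 t2 t3 t4 t5 t6 t7.
have P0 : 0 <= C1 * h by rewrite mulr_ge0// ltW.
have L2 : 0 <= 2 + L by rewrite addr_ge0.
have e1 : C1 * h * (2 + L) * d * (a - b + d * h) <=
    C1 * h * (2 + L) * d * (c - b + (d + 1) * h).
  by rewrite ler_wpM2l ?mulr_ge0//; lra.
have cb : 0 <= c - b by lra.
have e2 := mulr_ge0 (mulr_ge0 P0 (addr_ge0 ler01 L0)) cb.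
have e3 := mulr_ge0 (mulr_ge0 P0 (ltW h0)) t6.
have e4 := mulr_ge0 P0 (ltW h0).
clear - e1 e2 e3 e4 t1 t2 t3 t7.
lra.
Qed.

End Euler.

(** * Convergence of the scheme *)

Section Limit.
Context {R : realType} {H : completeNormedModType R} (ip : {dot H for @idfun R})
  (hH : hilbert_dot ip) (phi : H -> \bar R) (phi_convex : convex_efun phi)
  (phi_lsc : lower_semicontinuous phi) (phi_proper : proper_efun phi)
  (psi : H -> R) (g : H -> H)
  (g_sub : subgradient_map ip psi g)
  (g_lip : lipschitz_on_balls g)
  (E_min : R) (E_lb : forall z, (E_min%:E <= phi z + (psi z)%:E)%E)
  (lam V : R -> R)
  (lamV : forall s t, 0 <= s -> s <= t -> `|lam t - lam s| <= V t - V s)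
  (lam_min : forall T, 0 < T ->
    exists2 m, 0 < m & forall t, 0 <= t -> t <= T -> m <= lam t)
  (x0 v0 : H) (v0_sub : subdifferential ip phi x0 v0).

Local Notation dphi := (subdifferential ip phi).
Local Notation es := (euler_sequence ip phi g lam x0 v0).
Local Notation eb := (euler_bounds ip phi g lam V x0 v0).

Definition mesh n : R := 2^-1 ^+ n.

Lemma mesh_gt0 n : 0 < mesh n. Proof. by rewrite exprn_gt0// invr_gt0. Qed.

Lemma mesh_le1 n : mesh n <= 1.
Proof. by rewrite exprn_ile1// ?invr_ge0// invf_le1// ler1n. Qed.

Lemma meshS n : mesh n = 2 * mesh n.+1.
Proof. by rewrite /mesh exprS mulrA divff// mul1r. Qed.

(** If over every cell of a grid of step [h] the defect is at most [h] times the
variation of [lam] over the cell plus [h], the defects add up to [O(h)]. *)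
Lemma grid_stability T C : 0 < T -> 0 <= C ->
  exists2 D, 0 <= D & forall N h (x v y u : nat -> H), 0 < h -> N%:R * h <= T ->
  let small_residual x v := forall k, (k < N)%N ->
    `|residual g (lam (k%:R * h)) h (x k) (v k) (x k.+1) (v k.+1)|
       <= C * h * (V (k.+1%:R * h) - V (k%:R * h) + h) in
  small_residual x v -> small_residual y u ->
  (forall k, (k <= N)%N -> dphi (x k) (v k)) ->
  (forall k, (k <= N)%N -> dphi (y k) (u k)) ->
  (forall k, (k <= N)%N -> `|x k| <= C) -> (forall k, (k <= N)%N -> `|y k| <= C) ->
  x 0 = y 0 -> v 0 = u 0 ->
  `|x N - y N| <= D * h /\ `|v N - u N| <= D * h.
Proof.
move=> T0 C0; have [m m0 mlam] := lam_min T0; have [L L0 gL] := g_lip C.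
have VT : 0 <= V T - V 0 by rewrite subr_ge0 (V_le lamV)// ltW.
pose S := (V T - V 0) / m + T * (1 + L / m).
pose D := expR S * (2 * C * (V T - V 0 + T)).
have D0 : 0 <= D by rewrite mulr_ge0 ?expR_ge0// !mulr_ge0// addr_ge0// ltW.
exists (D + D / m); first by rewrite addr_ge0// divr_ge0// ltW.
move=> k h x v y u h0 kT small_residual xvr yur xv yu xC yC xy0 vu0.
have jT j : (j <= k)%N -> j%:R * h <= T by exact: grid_le.
pose a j := V (j.+1%:R * h) - V (j%:R * h).
pose rho j := C * h * (a j + h).
have Ba : \sum_(j < k) (a j / m + h * (1 + L / m)) =
    (V (k%:R * h) - V 0) / m + k%:R * h * (1 + L / m).
  clear; elim: k => [|k IH]; first by rewrite big_ord0 !mul0r subrr mul0r addr0.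
  by rewrite big_ord_recr/= IH /a -(natr1 k); move: (k%:R) => ?; ring.
have Br : \sum_(j < k) (2 * rho j) = 2 * C * h * (V (k%:R * h) - V 0 + k%:R * h).
  clear; elim: k => [|k IH]; first by rewrite big_ord0 !mul0r subrr addr0 mulr0.
  by rewrite big_ord_recr/= IH /rho /a -(natr1 k); move: (k%:R) => ?; ring.
have Vk : V (k%:R * h) <= V T by rewrite (V_le lamV)// mulr_ge0// ltW.
have V0k : V 0 <= V (k%:R * h) by rewrite (V_le lamV)// mulr_ge0// ltW.
have := @discrete_stability R H ip hH phi phi_proper g k (fun j => lam (j%:R * h)) a rho
  h m L x v y u m0 (ltW h0) L0.
case/(_ _ _ xv yu _ xvr yur xy0 vu0 _ erefl).
- by move=> j jk; apply: mlam; rewrite ?jT// mulr_ge0// ltW.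
- move=> j jk; apply: lamV; first by rewrite mulr_ge0// ltW.
  by rewrite ler_pM2r// ler_nat.
- by move=> j jk; apply: gL; [exact: xC|exact: yC].
rewrite Ba Br => b1 b2.
have BD : expR ((V (k%:R * h) - V 0) / m + k%:R * h * (1 + L / m)) *
     (2 * C * h * (V (k%:R * h) - V 0 + k%:R * h)) <= D * h.
  have -> : D * h = expR S * (2 * C * h * (V T - V 0 + T)) by rewrite /D; ring.
  apply: ler_pM; first exact: expR_ge0.
  - by rewrite !mulr_ge0 ?(ltW h0)// addr_ge0 ?subr_ge0// mulr_ge0// ltW.
  - rewrite ler_expR /S lerD//.
      by rewrite ler_pM2r ?invr_gt0// lerD2r.
    by rewrite ler_wpM2r// addr_ge0// divr_ge0// ltW.
  - by rewrite ler_wpM2l ?mulr_ge0// ?(ltW h0)//; lra.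
have Dm : 0 <= D / m * h by rewrite mulr_ge0 ?(ltW h0)// divr_ge0// ltW.
have Dh : 0 <= D * h by rewrite mulr_ge0// ltW.
split; last by rewrite (le_trans b2)// (le_trans BD)//; lra.
apply: (@le_trans _ _ (D / m * h)); last by lra.
by rewrite mulrAC ler_pdivlMr// mulrC (le_trans b1).
Qed.

(** Every second point of the scheme of step [mesh n.+1], viewed on the grid of
step [mesh n], satisfies the one-step estimate of that grid. *)
Lemma level_compare T C : 0 < T -> 0 <= C -> eb T C ->
  exists2 D, 0 <= D & forall n p p', es (mesh n) p -> es (mesh n.+1) p' ->
    forall k, k%:R * mesh n <= T ->
    `|(p' (2 * k)%N).1 - (p k).1| <= D * mesh n /\
    `|(p' (2 * k)%N).2 - (p k).2| <= D * mesh n.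
Proof.
move=> T0 C0 CT; have [D D0 DP] := grid_stability T0 C0; exists D => //.
move=> n p p' pe pe' k; set h := mesh n; set h' := mesh n.+1 => kT.
have h0 : 0 < h := mesh_gt0 n; have h0' : 0 < h' := mesh_gt0 _.
have hh : h = 2 * h' := meshS n.
have jT j : (j <= k)%N -> j%:R * h <= T by exact: grid_le.
have dbl j : (2 * j)%:R * h' = j%:R * h by rewrite natrM hh; ring.
have [pe0 peP _] := pe; have [pe0' peP' _] := pe'.
apply: (DP k h (fun j => (p' (2 * j)%N).1) (fun j => (p' (2 * j)%N).2)
  (fun j => (p j).1) (fun j => (p j).2)) => //.
- move=> j jk; have e2 : (2 * j + 2)%N = (2 * j.+1)%N by rewrite mulnS addnC.
  have [|_ _ _ _] := CT h' p' h0' (mesh_le1 _) pe' (2 * j)%N 2.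
    by rewrite e2 dbl jT.
  by rewrite e2 !dbl -hh.
- move=> j jk.
  have [|_ _ _ _] := CT h p h0 (mesh_le1 _) pe j 1%N.
    by rewrite addn1 jT.
  by rewrite addn1 mul1r.
- move=> j jk; have [|+ _ _ _ _] := CT h' p' h0' (mesh_le1 _) pe' (2 * j)%N 0;
    by rewrite ?addn0 ?dbl ?jT.
- by move=> j jk; have [|+ _ _ _ _] := CT h p h0 (mesh_le1 _) pe j 0; rewrite ?addn0 ?jT.
- by rewrite muln0 pe0 pe0'.
- by rewrite muln0 pe0 pe0'.
Qed.

Lemma subdifferential_closed (x v : nat -> H) (l w : H) :
  (forall n, dphi (x n) (v n)) -> x n @[n --> \oo] --> l -> v n @[n --> \oo] --> w ->
  dphi l w.
Proof.
move=> xv xl vw y; rewrite leNgt; apply/negP => lt.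
have yf : phi y \is a fin_num.
  case: phi_proper => /(_ y) yN _; rewrite fin_numE gt_eqF//= lt_eqF//.
  by rewrite (lt_le_trans lt)// leey.
have [b bl by_] : exists2 b, (b%:E < phi l)%E & fine (phi y) < b + ip w (y - l).
  move: lt; rewrite -(fineK yf); case: phi_proper => /(_ l) + _.
  case: (phi l) => [r| |]//.
    rewrite -EFinD lte_fin => _ yr; exists ((r + fine (phi y) - ip w (y - l)) / 2).
      by rewrite lte_fin; lra.
    by lra.
  by move=> _ _; exists (fine (phi y) - ip w (y - l) + 1); rewrite ?ltry//; lra.
have [W nW phiW] := phi_lsc bl.
have ipc : ip (v n) (y - x n) @[n --> \oo] --> ip w (y - l).
  by apply: (cvg_ip hH) => //; apply: cvgB => //; exact: cvg_cst.
have : b + ip w (y - l) <= fine (phi y).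
  apply: (cvgr_to_le (cvgD (cvg_cst b) ipc)).
  have : \forall n \near \oo, W (x n) by exact: xl.
  apply: filterS => n /phiW bn.
  rewrite -lee_fin (fineK yf) EFinD (le_trans _ (xv n y))//.
  by rewrite leeD2r// ltW.
by rewrite leNgt by_.
Qed.

Lemma geometric_cvg (u : nat -> H) D :
  (forall n, `|u n.+1 - u n| <= D * mesh n) -> exists l : H, u n @[n --> \oo] --> l.
Proof.
move=> uD.
have uS N n : `|u (N + n)%N - u N| <= 2 * D * (mesh N - mesh (N + n)).
  elim: n => [|n IH]; first by rewrite addn0 !subrr normr0 mulr0.
  have := uD (N + n)%N; have := ler_normD (u (N + n).+1 - u (N + n)%N) (u (N + n)%N - u N).
  have : D * mesh (N + n) = 2 * D * mesh (N + n).+1 by rewrite meshS; ring.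
  by rewrite addrA subrK addnS; move: IH; lra.
have D0 : 0 <= D.
  by have := le_trans (normr_ge0 _) (uD 0); rewrite pmulr_lge0// mesh_gt0.
apply: cauchy_sequence_cvg => e e0.
have [N DN] : exists N, 2 * D * mesh N < e.
  have m0 : mesh n @[n --> \oo] --> (0 : R).
    by apply: cvg_expr; rewrite ger0_norm ?invr_ge0// invf_lt1// ltr1n.
  have m1 : 2 * D * mesh n @[n --> \oo] --> (0 : R).
    by rewrite -[X in _ --> X](mulr0 (2 * D)); exact: cvgM (cvg_cst _) m0.
  by have [N _ /(_ N (leqnn N)) DN] := cvgr_lt _ m1 _ e0; exists N.
exists N => n /subnKC <-; rewrite distrC (le_lt_trans (uS _ _))// (le_lt_trans _ DN)//.
by have := mulr_ge0 D0 (ltW (mesh_gt0 (N + (n - N)))); lra.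
Qed.

(** The curve is the limit of the schemes of dyadic step, each extended to be
constant on the cells of its grid. The grid points below [s] tend to [s] from the left,
and continuity of [V] at [s] makes both [lam] and [V] converge along them. *)
Lemma euler_limit : exists x v : R -> H,
  [/\ x 0 = x0, v 0 = v0, forall t, 0 <= t -> dphi (x t) (v t) &
   forall T, 0 < T -> exists2 C, 0 <= C & forall s t, 0 <= s -> s <= t -> t <= T ->
     [/\ `|x t - x s| <= C * (t - s), `|v t - v s| <= C * (t - s) &
         0 < s -> V r @[r --> s] --> V s ->
         `|residual g (lam s) (t - s) (x s) (v s) (x t) (v t)|
           <= C * (t - s) * (V t - V s + (t - s))]].
Proof.
have /choice[P PE] : forall n, exists p, es (mesh n) p.
  move=> n; exact: (euler_sequence_exists hH phi_convex phi_lsc phi_proper g_sub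
    g_lip lam_min v0_sub (ltW (mesh_gt0 n))).
pose idx n t := Num.truncn (t / mesh n).
have idxP n t : 0 <= t -> (idx n t)%:R * mesh n <= t < (idx n t).+1%:R * mesh n.
  move=> t0; rewrite -ler_pdivlMr ?mesh_gt0// -ltr_pdivrMr ?mesh_gt0//.
  by apply: truncn_itv; rewrite divr_ge0// ltW// mesh_gt0.
have idxS n t : 0 <= t -> exists2 r, (r <= 1)%N & idx n.+1 t = (2 * idx n t + r)%N.
  move=> t0; have := idxP n t t0; have := idxP n.+1 t t0; rewrite (meshS n).
  move: (idx n t) (idx n.+1 t) => i j /andP[j1 j2] /andP[i1 i2].
  have ij : (2 * i <= j)%N.
    rewrite -ltnS -(ltr_nat R) natrM -(ltr_pM2r (mesh_gt0 n.+1)).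
    by rewrite (le_lt_trans _ j2)// (le_trans _ i1)// mulrAC mulrC mulrCA mulrA.
  have ji : (j < 2 * i + 2)%N.
    rewrite -(ltr_nat R) natrD natrM -(ltr_pM2r (mesh_gt0 n.+1)).
    rewrite (le_lt_trans j1)// (lt_le_trans i2)// -natr1.
    by move: (i%:R) => ?; lra.
  by exists (j - 2 * i)%N; [lia|rewrite subnKC].
have idx_le n s t : 0 <= s -> s <= t -> (idx n s <= idx n t)%N.
  by move=> s0 st; rewrite le_truncn// ler_pM2r// invr_gt0 mesh_gt0.
have bounds T : 0 < T -> exists2 C, 0 <= C & eb T C.
  move=> T0; exact: (euler_bounds_exist hH phi_proper g_sub g_lip E_lb lamV lam_min v0_sub T0).
have cvgs t : 0 <= t -> exists xv : H * H,
   (P n (idx n t)).1 @[n --> \oo] --> xv.1 /\ (P n (idx n t)).2 @[n --> \oo] --> xv.2.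
  move=> t0; have T0 : 0 < t + 1 by lra.
  have [C C0 CP] := bounds _ T0; have [D D0 DP] := level_compare T0 C0 CP.
  have step n : `|(P n.+1 (idx n.+1 t)).1 - (P n (idx n t)).1| <= (D + C) * mesh n /\
                `|(P n.+1 (idx n.+1 t)).2 - (P n (idx n t)).2| <= (D + C) * mesh n.
    have [r r1 er] := idxS n t t0.
    have /andP[i1 _] := idxP n t t0; have /andP[i2 _] := idxP n.+1 t t0.
    have [|d1 d2] := DP n _ _ (PE n) (PE n.+1) (idx n t); first by lra.
    have [|_ _ l1 l2 _] := CP _ _ (mesh_gt0 n.+1) (mesh_le1 _) (PE n.+1) (2 * idx n t)%N r.
      by rewrite -er; lra.
    have rm : C * (r%:R * mesh n.+1) <= C * mesh n.
      rewrite ler_wpM2l// (meshS n) ler_pM2r ?mesh_gt0//.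
      by rewrite (le_trans (_ : _ <= 1%:R)) ?ler_nat//; lra.
    by rewrite er mulrDl; split; [rewrite -(subrKA (P n.+1 (2 * idx n t)%N).1)|
      rewrite -(subrKA (P n.+1 (2 * idx n t)%N).2)];
      rewrite addrC (le_trans (ler_normD _ _))//; lra.
  have [l lP] := geometric_cvg (fun n => (step n).1).
  have [w wP] := geometric_cvg (fun n => (step n).2).
  by exists (l, w).
have mesh0 : mesh n @[n --> \oo] --> (0 : R).
  by apply: cvg_expr; rewrite ger0_norm ?invr_ge0// invf_lt1// ltr1n.
pose tau n t := (idx n t)%:R * mesh n.
have tau_le n t : 0 <= t -> tau n t <= t by move=> /(idxP n)/andP[].
have tau_cvg t : 0 <= t -> tau n t @[n --> \oo] --> t.
  move=> t0; apply: (@squeeze_cvgr _ _ _ _ (fun n => t - mesh n) (fun=> t)).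
  - apply: nearW => n; have /andP[i1 i2] := idxP n t t0.
    by rewrite tau_le// andbT; move: i2; rewrite -natr1 /tau; lra.
  - by rewrite -[X in _ --> X]subr0; apply: cvgB => //; exact: cvg_cst.
  - exact: cvg_cst.
have /choice[xv xvP] : forall t, exists xv : H * H, 0 <= t ->
   (P n (idx n t)).1 @[n --> \oo] --> xv.1 /\ (P n (idx n t)).2 @[n --> \oo] --> xv.2.
  move=> t; have [/cvgs[xv h]|t0] := leP 0 t; first by exists xv.
  by exists (0, 0).
have P0 n : P n (idx n 0) = (x0, v0).
  by have [<- _ _] := PE n; congr (P n); rewrite /idx mul0r truncn0.
exists (fun t => (xv t).1), (fun t => (xv t).2); split.
- have [h _] := xvP 0 (lexx _); symmetry; apply: (cvg_unique _ _ h) => //.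
  rewrite (_ : (fun n => _) = fun=> x0); first exact: cvg_cst.
  by apply/funext => n; rewrite P0.
- have [_ h] := xvP 0 (lexx _); symmetry; apply: (cvg_unique _ _ h) => //.
  rewrite (_ : (fun n => _) = fun=> v0); first exact: cvg_cst.
  by apply/funext => n; rewrite P0.
- move=> t t0; have [h1 h2] := xvP t t0; apply: subdifferential_closed h1 h2.
  by move=> n; have [_ + _] := PE n; apply.
move=> T T0; have [C C0 CP] := bounds T T0; exists C => // s t s0 st tT.
have t0 := le_trans s0 st.
have [xs vs] := xvP s s0; have [xt vt] := xvP t t0.
have bn n := CP _ _ (mesh_gt0 n) (mesh_le1 n) (PE n) (idx n s) (idx n t - idx n s)%N.
have e1 n : (idx n s + (idx n t - idx n s))%N = idx n t by rewrite subnKC// idx_le.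
have e2 n : (idx n t - idx n s)%:R * mesh n = tau n t - tau n s.
  by rewrite natrB ?idx_le// mulrBl.
have tauT n : tau n t <= T by rewrite (le_trans (tau_le n t t0)).
have bn' n : [/\ `|(P n (idx n t)).1 - (P n (idx n s)).1| <= C * (tau n t - tau n s),
   `|(P n (idx n t)).2 - (P n (idx n s)).2| <= C * (tau n t - tau n s) &
   `|residual g (lam (tau n s)) (tau n t - tau n s) (P n (idx n s)).1 (P n (idx n s)).2
       (P n (idx n t)).1 (P n (idx n t)).2| <=
     C * (tau n t - tau n s) * (V t - V (tau n s) + (tau n t - tau n s))].
  have := bn n; rewrite e1 e2 => /(_ (tauT n))[b1 b2 b3 b4 b5]; split => //.
  have tst : 0 <= tau n t - tau n s.
    by rewrite subr_ge0 /tau ler_pM2r ?mesh_gt0// ler_nat idx_le.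
  rewrite (le_trans b5)// ler_wpM2l ?mulr_ge0// !lerD2r (V_le lamV)//.
    by rewrite mulr_ge0// ltW// mesh_gt0.
  exact: tau_le.
have Dtau : C * (tau n t - tau n s) @[n --> \oo] --> C * (t - s).
  by apply: cvgM; [exact: cvg_cst|apply: cvgB; exact: tau_cvg].
split.
- apply: (ler_cvg_to (cvg_norm (cvgB xt xs)) Dtau).
  by apply: nearW => n; have [] := bn' n.
- apply: (ler_cvg_to (cvg_norm (cvgB vt vs)) Dtau).
  by apply: nearW => n; have [] := bn' n.
move=> sp Vs.
have Vtau : V (tau n s) @[n --> \oo] --> V s by exact: (cvg_comp _ _ (tau_cvg s s0) Vs).
have ltau : lam (tau n s) @[n --> \oo] --> lam s.
  apply/cvgrPdist_le => e e0.
  have /cvgrPdist_le/(_ e e0) := Vtau; apply: filterS => n Vle.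
  rewrite (le_trans (lamV _ (tau_le n s s0)))//.
    by rewrite mulr_ge0// ltW// mesh_gt0.
  by rewrite (le_trans _ Vle)// ler_norm.
have gx : g (P n (idx n s)).1 @[n --> \oo] --> g (xv s).1.
  have [L L0 gL] := g_lip C; apply/cvgrPdist_le => e e0.
  have xC n : `|(P n (idx n s)).1| <= C by have := bn n; rewrite e1 => /(_ (tauT n))[].
  have xsC : `|(xv s).1| <= C.
    by apply: (cvgr_to_le (cvg_norm xs)); apply: nearW.
  have L10 : 0 < L + 1 by lra.
  have /cvgrPdist_le/(_ _ (divr_gt0 e0 L10)) := xs.
  apply: filterS => n /(ler_wpM2l L0) h; rewrite (le_trans (gL _ _ xsC (xC n)))//.
  rewrite (le_trans h)// mulrA ler_pdivrMr// mulrC ler_pM2l//; lra.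
have rhs : C * (tau n t - tau n s) * (V t - V (tau n s) + (tau n t - tau n s)) @[n --> \oo]
   --> C * (t - s) * (V t - V s + (t - s)).
  apply: cvgM => //; apply: cvgD; first by apply: cvgB => //; exact: cvg_cst.
  by apply: cvgB; exact: tau_cvg.
have lhs : residual g (lam (tau n s)) (tau n t - tau n s) (P n (idx n s)).1 (P n (idx n s)).2
       (P n (idx n t)).1 (P n (idx n t)).2 @[n --> \oo] -->
     residual g (lam s) (t - s) (xv s).1 (xv s).2 (xv t).1 (xv t).2.
  apply: cvgD; first apply: cvgD.
  - by apply: cvgZ => //; exact: cvgB.
  - exact: cvgB.
  - by apply: cvgZ; [apply: cvgB; exact: tau_cvg|exact: cvgD].
apply: (ler_cvg_to (cvg_norm lhs) rhs).
by apply: nearW => n; have [] := bn' n.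
Qed.

End Limit.

(** * A maximal inequality for monotone functions *)

Section Maximal.
Context {R : realType}.
Local Notation mu := (@lebesgue_measure R).

(** The open intervals between the values of [r] at the ends of disjoint intervals
are disjoint and contained in [[lo, hi]], so their measures add up to at most
[hi - lo]. *)
Lemma disjoint_increments_le (I : choiceType) (D : seq I) (l u : I -> R) (r : R -> R) lo hi :
  {homo r : s t / s <= t} -> (forall t, lo <= r t <= hi) ->
  uniq D -> (forall i, i \in D -> l i < u i) ->
  trivIset [set` D] (fun i => `]l i, u i[%classic) ->
  \sum_(i <- D) (r (u i) - r (l i)) <= hi - lo.
Proof.
move=> rnd rb uD lu tD.
have lohi : lo <= hi by have /andP[h1 h2] := rb 0; exact: le_trans h1 h2.
pose F i := `]r (l i), r (u i)[%classic.
have mF i : measurable (F i) by exact: measurable_itv.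
have tF : trivIset [set` D] F.
  (* Were the images to overlap, so would the intervals themselves, at the
     middle of the larger left end and the smaller right end. *)
  move=> i j Di Dj [z []]; rewrite /F /= !in_itv/= => /andP[i1 i2] /andP[j1 j2].
  apply: tD => //; exists ((Num.max (l i) (l j) + Num.min (u i) (u j)) / 2) => /=.
  have uij : l j < u i by rewrite ltNge; apply/negP => /rnd; lra.
  have uji : l i < u j by rewrite ltNge; apply/negP => /rnd; lra.
  have := lu _ Di; have := lu _ Dj; rewrite ?in_itv/=.
  by case: (leP (l i) (l j)) => ?; case: (leP (u i) (u j)) => ? ? ?; split; apply/andP; split; lra.
have mF' : (mu (\bigcup_(i in [set` D]) F i) <= (hi - lo)%:E)%E.
  have -> : ((hi - lo)%:E = mu `[lo, hi]%classic)%E.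
    by rewrite lebesgue_measure_itv/= lte_fin; case: ltgtP lohi => // ->; rewrite subrr.
  apply: le_measure; rewrite ?inE.
  - by apply: fin_bigcup_measurable => // i _; exact: measurable_itv.
  - exact: measurable_itv.
  move=> z [i Di]; rewrite /F /= !in_itv/= => /andP[z1 z2].
  have /andP[? ?] := rb (l i); have /andP[? ?] := rb (u i).
  by apply/andP; split; lra.
rewrite -lee_fin (le_trans _ mF')// measure_fin_bigcup//; last by move=> i _; exact: mF.
rewrite -fsbig_seq// -sumEFin big_seq [leRHS]big_seq; apply: lee_sum => i Di.
change ((r (u i) - r (l i))%:E <= mu (F i))%E.
rewrite /F lebesgue_measure_itv/= lte_fin; case: ifPn => [_|]; first by rewrite EFinB.
by rewrite -leNgt lee_fin subr_le0.
Qed.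

(** Each point of the set lies in an interval with rational ends on which [r]
grows at a rate above [d / 2]. Finitely many of these countably many intervals
are covered by three times a disjoint subfamily (Vitali), whose total length is
at most [2 (hi - lo) / d]. *)
Lemma monotone_maximal_inequality (r : R -> R) lo hi d :
  {homo r : s t / s <= t} -> (forall t, lo <= r t <= hi) -> 0 < d ->
  exists U, [/\ measurable U, (mu U <= (6 * (hi - lo) / d)%:E)%E &
    [set t | exists s, d * `|s - t| < `|r s - r t|] `<=` U].
Proof.
move=> rnd rb d0.
pose good (i : rat * rat) := ((ratr i.1 : R) < ratr i.2) &&
  (d * (ratr i.2 - ratr i.1) < 2 * (r (ratr i.2) - r (ratr i.1))).
pose B (i : rat * rat) : set R := if good i
  then ball ((ratr i.1 + ratr i.2) / 2 : R) ((ratr i.2 - ratr i.1) / 2) else ball (0 : R) 1.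
have BE i : good i -> B i = `](ratr i.1), (ratr i.2)[%classic.
  move=> gi; rewrite /B gi ball_itv; move: (ratr i.1 : R) (ratr i.2 : R) => a b.
  have -> : (a + b) / 2 - (b - a) / 2 = a by lra.
  by have -> : (a + b) / 2 + (b - a) / 2 = b by lra.
have bB i : is_ball (B i) by rewrite /B; case: ifPn => _; exact: is_ball_ball.
have B0 i : B i !=set0.
  rewrite /B; case: ifPn => [/andP[gi _]|_]; last by exists 0; exact: ballxx.
  by eexists; apply: ballxx; lra.
pose U := \bigcup_(i in [set i | good i]) B i.
have oU : open U.
  by apply: bigcup_open => i _; rewrite /B; case: ifP => _; exact: ball_open.
exists U; split; first exact: measurable_realfun.open_measurable.
- pose s n := [seq i <- pmap (@unpickle (rat * rat)%type) (iota 0 n) | good i].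
  have mB i : measurable (B i).
    by apply: measurable_realfun.open_measurable; rewrite /B; case: ifP => _; exact: ball_open.
  pose F n := cover [set` s n] B.
  have UE : U = \bigcup_n F n.
    apply/seteqP; split=> [t [i gi Bt]|t [n _ [i + Bt]]].
      exists (pickle i).+1 => //; exists i => //.
      rewrite /mkset /s mem_filter gi mem_pmap; apply/mapP; exists (pickle i).
        by rewrite mem_iota add0n ltnSn.
      by rewrite pickleK.
    by rewrite /s /= mem_filter => /andP[gi _]; exists i.
  have mF n : measurable (F n).
    by apply: fin_bigcup_measurable.
  have ndF : {homo F : n m / (n <= m)%N >-> (n <= m)%O}.
    move=> n m nm; apply/subsetPset => t [i /= + Bt]; rewrite mem_filter => /andP[gi].
    rewrite mem_pmap => /mapP[j jn ij]; exists i => //=.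
    rewrite mem_filter gi mem_pmap /=; apply/mapP; exists j => //.
    by move: jn; rewrite !mem_iota !add0n/= => /leq_trans; apply.
  have := @nondecreasing_cvg_mu _ _ R mu F mF (bigcup_measurable (fun n _ => mF n)) ndF.
  rewrite -UE => Fcvg.
  apply: (cvge_to_le Fcvg); apply: nearW => n /=.
  have [D [uD Ds tD cD]] := vitali_lemma_finite_cover bB B0 (s n).
  have gD i : i \in D -> good i by move=> /Ds; rewrite mem_filter => /andP[].
  apply: (@le_trans _ _ (\sum_(i <- D) (3 * (ratr i.2 - ratr i.1 : R))%:E)%E).
    rewrite fsbig_seq//.
    have -> : (\sum_(i \in [set` D]) (3 * (ratr i.2 - ratr i.1 : R))%:E =
               \sum_(i \in [set` D]) mu (scale_ball 3 (B i)))%E.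
      apply: eq_fsbigr => i; rewrite inE /= => /gD gi.
      rewrite /B gi scale_ballE// lebesgue_measure_ball//.
        by congr (_%:E); lra.
      by case/andP: gi => g1 _; lra.
    apply: content_sub_fsum => //; [exact: finite_seq| |exact: mF].
    move=> i _; apply: measurable_realfun.open_measurable.
    by rewrite /= (ballE (is_scale_ball 3 (bB i))); exact: ball_open.
  rewrite sumEFin lee_fin.
  have := @disjoint_increments_le _ D (fun i => ratr i.1) (fun i => ratr i.2) r lo hi rnd rb uD.
  have -> : 6 * (hi - lo) / d = 6 / d * (hi - lo) by ring.
  move=> H; have {}H : \sum_(i <- D) (r (ratr i.2) - r (ratr i.1)) <= hi - lo.
    apply: H; first by move=> i /gD/andP[].
    by move=> i j Di Dj; rewrite -!BE ?gD//; exact: tD.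
  apply: le_trans (ler_wpM2l _ H); last by rewrite divr_ge0// ltW.
  rewrite mulr_sumr big_seq [leRHS]big_seq; apply: ler_sum => i /gD/andP[_ g2].
  rewrite mulrAC ler_pdivlMr//.
  by move: g2; lra.
- move=> t /= [s].
  have [->|st] := eqVneq s t; first by rewrite !subrr normr0 mulr0 ltxx.
  move=> h.
  have step a b : a < b -> d * (b - a) < r b - r a -> t = a \/ t = b -> U t.
    move=> ab rab tab.
    have ha : a - (b - a) / 4 < a by lra.
    have hb : b < b + (b - a) / 4 by lra.
    have [p] := rat_in_itvoo ha; have [q] := rat_in_itvoo hb.
    rewrite !in_itv/= => /andP[q1 q2] /andP[p1 p2].
    have gpq : good (p, q).
      rewrite /good/=; apply/andP; split; first by lra.
      have := rnd _ _ (ltW p2); have := rnd _ _ (ltW q1).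
      have : d * (ratr q - ratr p) <= d * (3 / 2 * (b - a)) by rewrite ler_pM2l//; lra.
      by have : 0 < d * (b - a); [rewrite mulr_gt0 ?subr_gt0 | lra].
    by exists (p, q) => //; rewrite BE// /= in_itv/=; case: tab => ->; apply/andP; split; lra.
  case: (ltgtP s t) st h => // st _ h.
    apply: (step s t) => //; last by right.
    move: h; rewrite ltr0_norm ?subr_lt0// ler0_norm ?subr_le0 ?rnd ?ltW//.
    by rewrite !opprB.
  apply: (step t s) => //; last by left.
  by move: h; rewrite gtr0_norm ?subr_gt0// ger0_norm ?subr_ge0 ?rnd ?ltW.
Qed.

End Maximal.

(** * Almost everywhere differentiability of Lipschitz curves *)

Section Small.
Context {R : realType}.
Local Notation mu := (@lebesgue_measure R).
Implicit Types (A B : set R) (e : R).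

(** Outer measure at most [e], for a set that may fail to be measurable. *)
Definition small A e := exists U, [/\ measurable U, (mu U <= e%:E)%E & A `<=` U].

Lemma smallS A B e e' : A `<=` B -> e <= e' -> small B e -> small A e'.
Proof.
move=> AB ee' [U [mU Ue BU]]; exists U; split => //; last exact: subset_trans BU.
by rewrite (le_trans Ue)// lee_fin.
Qed.

Lemma smallU A B e e' : small A e -> small B e' -> small (A `|` B) (e + e').
Proof.
move=> [U [mU Ue AU]] [W [mW We BW]]; exists (U `|` W); split.
- exact: measurableU.
- rewrite (le_trans (measureU2 _ mU mW))// EFinD leeD//.
- exact: setUSS.
Qed.

Lemma small_set1 (c : R) : small [set c] 0.
Proof. by exists [set c]; split; rewrite ?lebesgue_measure_set1. Qed.

Lemma negligible_small A : (forall e, 0 < e -> small A e) -> mu.-negligible A.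
Proof.
move=> sA.
have /choice[U UP] : forall n, exists U, [/\ measurable U, (mu U <= n.+1%:R^-1%:E)%E & A `<=` U].
  by move=> n; apply: sA; rewrite invr_gt0.
have mI : measurable (\bigcap_n U n).
  by apply: bigcapT_measurable => n; have [] := UP n.
exists (\bigcap_n U n); split => //; last first.
  by move=> t At n _; have [_ _] := UP n; apply.
apply/eqP; rewrite eq_le measure_ge0 andbT.
apply/lee_addgt0Pr => e e0; rewrite add0e.
have [N _ /(_ _ (leqnn N)) Ne] := near_infty_natSinv_lt (PosNum e0).
have [mUN UN _] := UP N.
apply: le_trans (_ : mu (U N) <= _)%E.
  by apply: le_measure; rewrite ?inE//; exact: bigcap_inf.
by rewrite (le_trans UN)// lee_fin ltW.
Qed.

End Small.

Section Lipschitz.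
Context {R : realType} {H : completeNormedModType R} (ip : {dot H for @idfun R})
  (hH : hilbert_dot ip) (f : R -> H) (L : R)
  (fL : forall s t, `|f t - f s| <= L * `|t - s|).
Local Notation mu := (@lebesgue_measure R).

(** The quadratic energies of the polygonal curves inscribed in [f]. Generating
these sums by concatenation avoids any representation of the partitions. *)
Inductive energy : R -> R -> R -> Prop :=
| energy_chord a b : a <= b -> energy a b (`|f b - f a| ^+ 2 / (b - a))
| energy_cat a c b y z : energy a c y -> energy c b z -> energy a b (y + z).

Lemma energy_bounds a b y : energy a b y -> a <= b /\ 0 <= y <= L ^+ 2 * (b - a).
Proof.
elim=> {a b y} [a b ab|a c b y z _ [ac /andP[y0 yL]] _ [cb /andP[z0 zL]]].
  split=> //; rewrite divr_ge0 ?exprn_ge0 ?subr_ge0//=.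
  move: ab; rewrite le_eqVlt => /orP[/eqP ->|ab]; first by rewrite !subrr normr0 expr0n mul0r mulr0.
  rewrite ler_pdivrMr ?subr_gt0// -mulrA -expr2 -exprMn.
  have := fL a b; rewrite (gtr0_norm (_ : 0 < b - a)) ?subr_gt0// => fab.
  by rewrite lerXn2r// nnegrE// (le_trans _ fab).
by split; [exact: le_trans cb|apply/andP; split; lra].
Qed.

Definition total_energy a b := sup [set y | energy a b y].

Lemma energy_has_sup a b : a <= b -> has_sup [set y | energy a b y].
Proof.
move=> ab; split; first by eexists; exact: energy_chord.
by exists (L ^+ 2 * (b - a)) => y /energy_bounds[_ /andP[]].
Qed.

Lemma energy_le_total a b y : energy a b y -> y <= total_energy a b.
Proof.
by move=> ey; apply: sup_upper_bound => //; apply: energy_has_sup; have [] := energy_bounds ey.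
Qed.

Lemma total_energyD a c b : a <= c -> c <= b ->
  total_energy a c + total_energy c b <= total_energy a b.
Proof.
move=> ac cb; apply/ler_addgt0Pr => e e0.
have e2 : 0 < e / 2 by lra.
have [y ey yq] := sup_adherent e2 (energy_has_sup ac).
have [z ez zq] := sup_adherent e2 (energy_has_sup cb).
have := energy_le_total (energy_cat ey ez).
by rewrite /total_energy; lra.
Qed.

Lemma total_energyxx a : total_energy a a = 0.
Proof.
apply/eqP; rewrite eq_le; apply/andP; split.
  apply: ge_sup; first exact: (energy_has_sup (lexx a)).1.
  by move=> y /energy_bounds[_ /andP[_]]; rewrite subrr mulr0.
have := energy_le_total (energy_chord (lexx a)).
by rewrite subrr normr0 expr0n mul0r.
Qed.

(** At the other points the difference quotients are eventually within [d] of a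
single vector; by completeness [f] is derivable wherever this holds for all [d]. *)
Definition oscillating d := [set t | ~ exists A r, 0 < r /\
  forall s, `|s - t| < r -> `|f s - f t - (s - t) *: A| <= d * `|s - t| ].

(** Subtract from [f] its chord, of slope [A]. The square of an increment of the
difference is at most the length of the increment of time times the increment of
[r0 t = total_energy a t - 2 ip (f t) A + t |A|^2]. Hence [r0] is nondecreasing, with
total increase the gap between the total energy and the energy of the chord, and
[f] can oscillate more than [d] only where [r0] grows at a rate above [d^2]. *)
Lemma small_oscillating_chord a b d : a <= b -> 0 < d ->
  small (oscillating d `&` `]a, b[)
    (6 / d ^+ 2 * (total_energy a b - `|f b - f a| ^+ 2 / (b - a))).
Proof.
rewrite le_eqVlt => /orP[/eqP <- d0|ab d0].
  rewrite total_energyxx !subrr normr0 expr0n mul0r subr0 mulr0.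
  apply: smallS (small_set1 a) => // t [_] /=; rewrite in_itv/= => /andP[].
  by move=> /lt_trans h /h; rewrite ltxx.
have ba : b - a != 0 by rewrite gt_eqF// subr_gt0.
have [A AE] : exists A, (b - a) *: A = f b - f a.
  by exists ((b - a)^-1 *: (f b - f a)); rewrite scalerA divff// scale1r.
pose r0 t := total_energy a t - 2 * ip (f t) A + t * ip A A.
pose cl t := Num.max a (Num.min b t).
have clP t : a <= cl t <= b.
  by rewrite /cl le_max lexx ge_max (ltW ab) ge_min lexx.
have cl_id t : a <= t -> t <= b -> cl t = t.
  by move=> at_ tb; rewrite /cl (min_idPr tb) (max_idPr at_).
have cl_le s t : s <= t -> cl s <= cl t.
  by move=> st; rewrite /cl ge_max !le_max lexx/= le_min !ge_min lexx st orbT orbT.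
have r0P s t : a <= s -> s < t -> t <= b ->
    `|f t - f s - (t - s) *: A| ^+ 2 <= (t - s) * (r0 t - r0 s).
  move=> as_ st tb.
  have q := total_energyD as_ (ltW st).
  have := le_trans (energy_le_total (energy_chord (ltW st)))
    (_ : _ <= total_energy a t - total_energy a s).
  move=> /(_ ltac:(lra)); rewrite ler_pdivrMr ?subr_gt0// => e.
  rewrite !hH !(ipDl, ipDr, ipNl, ipNr, ipZl, ipZr) in e *.
  rewrite /r0 ?(ipC ip A (f t)) ?(ipC ip A (f s)) (ipC ip (f s) (f t)) in e *.
  by move: e; move: (total_energy _ _) (total_energy _ _) => E1 E2 e; lra.
have r0_le s t : a <= s -> s <= t -> t <= b -> r0 s <= r0 t.
  move=> as_; rewrite le_eqVlt => /orP[/eqP -> //|st] tb.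
  have := r0P s t as_ st tb => /(le_trans (exprn_ge0 _ (normr_ge0 _))).
  by rewrite pmulr_rge0 ?subr_gt0// subr_ge0.
have rhomo : {homo (r0 \o cl) : s t / s <= t}.
  move=> s t st; have /andP[? ?] := clP s; have /andP[? ?] := clP t.
  by apply: r0_le => //; exact: cl_le.
have rb t : r0 a <= (r0 \o cl) t <= r0 b.
  by have /andP[? ?] := clP t; rewrite /= !r0_le.
have [U [mU Ule AU]] := monotone_maximal_inequality rhomo rb (exprn_gt0 2 d0).
exists U; split => //.
  apply: (le_trans Ule); rewrite lee_fin le_eqVlt; apply/orP; left; apply/eqP.
  rewrite mulrAC; congr (_ * _); rewrite /r0 total_energyxx.
  have -> : `|f b - f a| ^+ 2 / (b - a) = (b - a) * ip A A.
    rewrite -AE normrZ exprMn real_normK ?num_real// hH expr2 mulrAC.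
    by rewrite mulfK// mulrC.
  have : ip (f b) A - ip (f a) A = (b - a) * ip A A by rewrite -ipZl AE ipDl ipNl.
  by lra.
move=> t [osc /=]; rewrite in_itv/= => /andP[at_ tb]; apply: AU => /=.
apply: contrapT => /forallNP nex; apply: osc.
exists A, (Num.min (t - a) (b - t)); split; first by rewrite lt_min !subr_gt0 at_ tb.
move=> s; rewrite lt_min => /andP[sa sb].
have sa' : a <= s by move: sa; rewrite ltr_norml => /andP[]; lra.
have sb' : s <= b by move: sb; rewrite ltr_norml => /andP[]; lra.
have := nex s; rewrite /= (cl_id s)// (cl_id t (ltW at_) (ltW tb)) => /negP; rewrite -leNgt => rst.
apply: ler_sqr_cancel; first by rewrite mulr_ge0// ltW.
rewrite exprMn.
apply: (@le_trans _ _ (`|s - t| * `|r0 s - r0 t|)); last first.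
  by have := ler_wpM2l (normr_ge0 (s - t)) rst; lra.
case: (ltgtP s t) => [st|st|->].
- have -> : f s - f t - (s - t) *: A = - (f t - f s - (t - s) *: A).
    by apply: (ip_ext hH) => w; rewrite !(ipDl, ipNl, ipZl); ring.
  rewrite normrN (le_trans (r0P s t sa' st (ltW tb)))//.
  have rr := r0_le s t sa' (ltW st) (ltW tb).
  by rewrite (distrC s) (distrC (r0 s)) ler_pM ?subr_ge0 ?ler_norm// ltW.
- rewrite (le_trans (r0P t s (ltW at_) st sb'))//.
  have rr := r0_le t s (ltW at_) (ltW st) sb'.
  by rewrite ler_pM ?subr_ge0 ?ler_norm// ltW.
- by rewrite !subrr scale0r subrr !normr0 expr0n /= ?mulr0 ?mul0r lexx.
Qed.

(** The estimate for chords adds up along the cells of a partition. *)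
Lemma small_oscillating a b y d : 0 < d -> energy a b y ->
  small (oscillating d `&` `]a, b[) (6 / d ^+ 2 * (total_energy a b - y)).
Proof.
move=> d0; have c0 : 0 <= 6 / d ^+ 2 by rewrite divr_ge0 ?exprn_ge0// ltW.
elim=> {a b y} [a b ab|a c b y z ey IHy ez IHz].
  exact: small_oscillating_chord.
have [ac _] := energy_bounds ey; have [cb _] := energy_bounds ez.
apply: smallS (smallU (smallU IHy (small_set1 c)) IHz).
  move=> t [ot]; rewrite /= !in_itv/= => /andP[at_ tb].
  case: (ltgtP t c) => [tc|ct|->]; last by left; right.
    by left; left; split => //=; rewrite ?in_itv/= at_.
  by right; split => //=; rewrite ?in_itv/= ct.
rewrite addr0 -mulrDr ler_wpM2l//.
by have := total_energyD ac cb; lra.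
Qed.

Lemma oscillating_negligible a b d : a < b -> 0 < d ->
  mu.-negligible (oscillating d `&` `]a, b[).
Proof.
move=> ab d0; apply: negligible_small => e e0.
have e1 : 0 < e * d ^+ 2 / 6 by rewrite divr_gt0// mulr_gt0// exprn_gt0.
have [y ey yq] := sup_adherent e1 (energy_has_sup (ltW ab)).
apply: smallS (small_oscillating d0 ey) => //.
rewrite mulrAC ler_pdivrMr ?exprn_gt0//.
by move: yq; rewrite -/(total_energy a b); lra.
Qed.

Lemma lipschitz_derivable_ae : {ae mu, forall t, derivable f t 1}.
Proof.
have neg : mu.-negligible (\bigcup_n \bigcup_k
    (oscillating k.+1%:R^-1 `&` `](- n.+1%:R), n.+1%:R[ : set R)).
  apply: negligible_bigcup => n; apply: negligible_bigcup => k.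
  by apply: oscillating_negligible => //; rewrite -subr_gt0 opprK addr_gt0.
apply: negligibleS neg => t /= nd.
apply: contrapT => nosc; apply: nd.
apply/cauchy_cvgP; apply: cauchy_exP => e e0.
have [k _ /(_ _ (leqnn k)) ke] := near_infty_natSinv_lt (PosNum e0).
have [A [r [r0 rP]]] : exists A r, 0 < r /\
  forall s, `|s - t| < r -> `|f s - f t - (s - t) *: A| <= k.+1%:R^-1 * `|s - t|.
  apply: contrapT => no; apply: nosc.
  exists (Num.truncn `|t|) => //; exists k => //; split => //=.
  rewrite in_itv/= -ltr_norml.
  by have /andP[] := truncn_itv (normr_ge0 t).
exists A.
change (\forall h \near (0 : R)^', ball A e (h^-1 *: (f (h *: 1 + t) - f t))).
near=> h.
have h0 : h != 0 by near: h; exact: nbhs_dnbhs_neq.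
have hr : `|h| < r.
  by near: h; exact: dnbhs0_lt.
have := rP (h + t); rewrite addrK => /(_ hr) hle.
rewrite -ball_normE /= distrC (le_lt_trans _ ke)// [h *: 1]mulr1.
have -> : h^-1 *: (f (h + t) - f t) - A = h^-1 *: (f (h + t) - f t - h *: A).
  by rewrite [RHS]scalerBr scalerA mulVf// scale1r.
by rewrite normrZ normfV ler_pdivrMl ?normr_gt0// mulrC.
Unshelve. all: by end_near. Qed.

End Lipschitz.

(** * Absolutely continuous curves *)

Section AbsContinuity.
Context {R : realType} {H : completeNormedModType R}.
Local Notation mu := (@lebesgue_measure R).

(** Cousin's lemma: a property of intervals that is stable under concatenation and
holds for the short intervals around each point holds for [[a, b]]. *)
Lemma interval_induction (P : R -> R -> Prop) a b : a <= b ->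
  (forall s m t, a <= s -> s <= m -> m <= t -> t <= b -> P s m -> P m t -> P s t) ->
  (forall t, a <= t -> t <= b -> exists2 r, 0 < r & forall s u, a <= s -> s <= t ->
     t <= u -> u <= b -> t - s < r -> u - t < r -> P s u) ->
  P a b.
Proof.
move=> ab Ptrans Ploc.
pose S := [set t | a <= t <= b /\ P a t].
have Sa : S a.
  split; first by rewrite lexx.
  by have [r r0] := Ploc a (lexx _) ab; apply; rewrite ?lexx ?subrr.
have supS : has_sup S by split; [exists a|exists b => t [/andP[]]].
have Sb t : S t -> t <= b by case=> /andP[].
pose c := sup S.
have ac : a <= c by exact: sup_upper_bound.
have cb : c <= b by apply: ge_sup => //; exists a.
have [r r0 Pr] := Ploc c ac cb.
have [t [/andP[at_ tb] Pat] ct] := sup_adherent r0 supS; rewrite -/c in ct.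
have tc : t <= c by apply: sup_upper_bound => //; split; rewrite ?at_.
have Su u : c <= u -> u <= b -> u - c < r -> S u.
  move=> cu ub ur; split; first by rewrite (le_trans ac cu).
  by apply: (Ptrans a t u) => //; [lra|apply: Pr => //; lra].
move: cb; rewrite le_eqVlt => /orP[/eqP cb|cb].
  by have [] : S b; [apply: Su; rewrite ?cb ?subrr ?lexx|].
have [cu ub] : c <= Num.min b (c + r / 2) /\ Num.min b (c + r / 2) <= b.
  by rewrite le_min ge_min lexx (ltW cb)/=; split => //; lra.
have : Num.min b (c + r / 2) <= c.
  apply: sup_upper_bound => //; apply: Su => //.
  have : Num.min b (c + r / 2) <= c + r / 2 by rewrite ge_min lexx orbT.
  by move: (Num.min _ _) => m; lra.
by rewrite ge_min leNgt cb/=; lra.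
Qed.

Lemma derivable_expansion (f : R -> H) t : derivable f t 1 ->
  forall e, 0 < e -> exists2 r, 0 < r &
    forall s, `|s - t| < r -> `|f s - f t - (s - t) *: derive1 f t| <= e * `|s - t|.
Proof.
move=> df e e0; rewrite derive1E; have /cvgrPdist_le/(_ _ e0) := df.
rewrite -/(derive f t 1) => /nbhs_ballP[r /= r0 rP]; exists r => // s sr.
have [->|st] := eqVneq s t; first by rewrite !subrr scale0r subr0 !normr0 mulr0.
have := rP (s - t); rewrite -ball_normE /= sub0r normrN => /(_ sr).
rewrite subr_eq0 => /(_ st); rewrite [_ *: 1]mulr1 subrK => h.
have st0 : s - t != 0 by rewrite subr_eq0.
have -> : f s - f t - (s - t) *: 'D_1 f t = - ((s - t) *: ('D_1 f t - (s - t)^-1 *: (f s - f t))).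
  by rewrite scalerBr scalerA divff// scale1r opprB.
by rewrite normrN normrZ mulrC ler_wpM2r.
Qed.

Lemma abs_continuous_onS (f : R -> H) a b c d : a <= c -> d <= b ->
  abs_continuous_on a b f -> abs_continuous_on c d f.
Proof.
move=> ac db fac e /fac[r r0 rP]; exists r => // n l u lu.
by apply: rP => i; have [h1 [h2 h3]] := lu i; split; [|split] => //; lra.
Qed.

Lemma lipschitz_abs_continuous (f : R -> H) a b C :
  (forall s t, a <= s -> s <= t -> t <= b -> `|f t - f s| <= C * (t - s)) ->
  abs_continuous_on a b f.
Proof.
move=> fC e e0; have C0 : 0 < `|C| + 1 by rewrite ltr_wpDl.
exists (e / (`|C| + 1)); first exact: divr_gt0.
move=> n l u lu _ lue; rewrite ltr_pdivlMr// in lue.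
apply: le_lt_trans lue; rewrite mulr_suml; apply: ler_sum => i _.
have [h1 [h2 h3]] := lu i.
rewrite (le_trans (fC _ _ h1 h2 h3))// mulrC ler_wpM2l ?subr_ge0//.
by rewrite (le_trans (ler_norm _))// lerDl.
Qed.

(** The upper limit of the difference quotients of [f] at [t] is at most [M]. *)
Definition growth_at (f : R -> H) (M t : R) := forall e, 0 < e ->
  exists2 r, 0 < r & forall w, `|w - t| < r -> `|f w - f t| <= (M + e) * `|w - t|.

Lemma derivable_growth (f : R -> H) M t :
  derivable f t 1 -> `|derive1 f t| <= M -> growth_at f M t.
Proof.
move=> df dM e e0; have [r r0 rP] := derivable_expansion df e0; exists r => // w /rP h.
rewrite -[f w - f t](subrK ((w - t) *: derive1 f t)) (le_trans (ler_normD _ _))//.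
by rewrite normrZ; have := ler_wpM2l (normr_ge0 (w - t)) dM; lra.
Qed.

(** Enclose the exceptional null set in an open set [U] of small measure. Around a
point outside [U] the increments of [f] are at most [M + e] times the length;
a short interval around a point of [U] is contained in [U]. By Cousin's lemma
[[a, b]] is split into finitely many such intervals, and the increments of [f]
over those in [U] add up to less than [e] by absolute continuity. *)
Lemma abs_continuous_bound (f : R -> H) a b M : a <= b -> 0 <= M ->
  abs_continuous_on a b f ->
  {ae mu, forall t, a < t -> t < b -> growth_at f M t} ->
  `|f b - f a| <= M * (b - a).
Proof.
move=> ab M0 fac [N [mN N0 Nbad]].
apply/ler_addgt0Pr => e1 e10.
pose e := e1 / (b - a + 1).
have e0 : 0 < e by rewrite divr_gt0//; lra.
suff : `|f b - f a| <= (M + e) * (b - a) + e.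
  have : e * (b - a + 1) = e1 by rewrite divfK// gt_eqF//; lra.
  lra.
have [d d0 facd] := fac e e0.
pose N' := N `|` [set a; b].
have mab : measurable [set a; b] by apply: measurableU.
have N'0 : mu N' = 0%E.
  apply/eqP; rewrite eq_le measure_ge0 andbT (le_trans (measureU2 _ mN mab))//.
  have -> : (mu N + mu [set a; b] = mu [set a; b])%E by rewrite (N0 : mu N = 0%E) add0e.
  apply: (@le_trans _ _ (mu [set a] + mu [set b])%E); first exact: measureU2.
  by rewrite !lebesgue_measure_set1 adde0.
have mN' : measurable N' by exact: measurableU.
have [U [oU N'U Ud]] : exists U, [/\ open U, N' `<=` U & (mu (U `\` N') < d%:E)%E].
  apply: lebesgue_regularity_outer => //.
  exact: (eq_ind_r (fun z => z < +oo)%E (ltry 0) N'0).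
have mU : measurable U by exact: measurable_realfun.open_measurable.
have {}Ud : (mu U < d%:E)%E.
  apply: le_lt_trans Ud; rewrite -{1}(setDUK N'U).
  apply: (@le_trans _ _ (mu N' + mu (U `\` N'))%E).
    exact: (measureU2 _ mN' (measurableD mU mN')).
  by rewrite N'0 add0e.
(* [F] lists the intervals contained in [U], from left to right. *)
pose P s t := exists F : seq (R * R),
  [/\ {in F, forall p, s <= p.1 /\ p.1 <= p.2 /\ p.2 <= t},
      pairwise (fun p q => p.2 <= q.1) F,
      {in F, forall p, `]p.1, p.2[ `<=` U} &
      `|f t - f s| <= (M + e) * (t - s) + \sum_(p <- F) `|f p.2 - f p.1|].
have [F [Fab Fpw FU Fle]] : P a b.
  apply: interval_induction => //.
    move=> s m t as_ sm mt tb [F [F1 F2 F3 F4]] [G [G1 G2 G3 G4]].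
    exists (F ++ G); split.
    - move=> p; rewrite mem_cat => /orP[/F1|/G1] [? [? ?]]; lra.
    - rewrite pairwise_cat F2 G2 /= andbT; apply/allrelP => p q /F1 ? /G1 ?; lra.
    - by move=> p; rewrite mem_cat => /orP[/F3|/G3].
    rewrite big_cat/=.
    have : `|f t - f s| <= `|f t - f m| + `|f m - f s|.
      by rewrite (le_trans _ (ler_normD _ _))// addrA subrK.
    by move: F4 G4; lra.
  move=> t at_ tb; have [tU|tU] := pselect (U t).
    have /nbhs_ballP[r /= r0 rU] : nbhs t U by exact: open_nbhs_nbhs.
    exists r => // s u as_ st tu ub sr ur; exists [:: (s, u)]; split => //=.
    - by move=> p; rewrite inE => /eqP -> /=; split => //; lra.
    - move=> p; rewrite inE => /eqP -> z /=; rewrite in_itv/= => /andP[sz zu].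
      by apply: rU; rewrite -ball_normE /= ltr_norml; apply/andP; split; lra.
    - by rewrite big_seq1 lerDr mulr_ge0//; lra.
  have [ta tb'] : a < t /\ t < b.
    split; rewrite lt_neqAle ?at_ ?tb andbT; apply/eqP => E; apply: tU; apply: N'U; right.
      by left; rewrite -E.
    by right; rewrite -E.
  have ft : growth_at f M t.
    apply: contrapT => nd; apply: tU; apply: N'U; left; apply: Nbad => /= h.
    by apply: nd; exact: h.
  have [r r0 bound] := ft e e0; exists r => // s u as_ st tu ub sr ur.
  exists [::]; split => //; rewrite big_nil addr0.
  have := bound s; have := bound u; rewrite (distrC s) !ger0_norm ?subr_ge0//.
  move=> /(_ ur) h1 /(_ sr); rewrite distrC => h2.
  have : `|f u - f s| <= `|f u - f t| + `|f t - f s|.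
    by rewrite (le_trans _ (ler_normD _ _))// addrA subrK.
  by lra.
(* With the default value (0, 0) the interval of index [i] is empty beyond [F]. *)
pose l i := (nth (0, 0) F i).1; pose u i := (nth (0, 0) F i).2.
pose G i := `]l i, u i[%classic : set R.
have mG i : measurable (G i) by exact: measurable_itv.
have tG : trivIset setT G.
  move=> i j _ _ [z []]; rewrite /G /= !in_itv/= => /andP[i1 i2] /andP[j1 j2].
  have szF k : l k < u k -> (k < size F)%N.
    by rewrite ltnNge => lu; apply/negP => kF; move: lu; rewrite /l /u nth_default// ltxx.
  have iF := szF _ (lt_trans i1 i2); have jF := szF _ (lt_trans j1 j2).
  have pw := pairwiseP (0, 0) Fpw.
  case: (ltngtP i j) => // ij.
    by have := pw i j iF jF ij; rewrite -/(u i) -/(l j) leNgt (lt_trans j1 i2).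
  by have := pw j i jF iF ij; rewrite -/(u j) -/(l i) leNgt (lt_trans i1 j2).
have memF i : (i < size F)%N -> nth (0, 0) F i \in F by move=> ?; exact: mem_nth.
have lu i : (i < size F)%N -> l i <= u i by move=> /memF/Fab[_ []].
apply: (le_trans Fle); rewrite lerD2l (big_nth (0, 0)) big_mkord ltW//.
apply: (facd (size F) (fun i => l i) (fun i => u i)).
- by move=> i; have [] := Fab _ (memF _ (ltn_ord i)).
- by move=> i j _ _ h; apply: val_inj; exact: tG.
rewrite -lte_fin; apply: le_lt_trans Ud.
have -> : (\sum_(i < size F) (u i - l i))%:E = mu (\big[setU/set0]_(i < size F) G i).
  rewrite measure_bigsetU// -sumEFin; apply: eq_bigr => i _.
  change ((u i - l i)%:E = mu (G i)); rewrite /G lebesgue_measure_itv /= lte_fin.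
  have := lu i (ltn_ord i); rewrite le_eqVlt => /orP[/eqP -> | ->].
    by rewrite ltxx subrr.
  by rewrite EFinB.
apply: le_measure; rewrite ?inE//; first by apply: bigsetU_measurable => i _; exact: mG.
rewrite -bigcup_mkord => z [i /= iF]; exact: FU (memF _ iF) z.
Qed.

End AbsContinuity.

(** * Functions of bounded variation *)

Section Variation.
Context {R : realType}.
Local Notation mu := (@lebesgue_measure R).

Definition clamp (T t : R) := Num.max 0 (Num.min T t).

Lemma clamp_id T t : 0 <= t -> t <= T -> clamp T t = t.
Proof. by move=> t0 tT; rewrite /clamp (min_idPr tT) (max_idPr t0). Qed.

Lemma clamp_itv T t : 0 <= T -> 0 <= clamp T t <= T.
Proof. by move=> T0; rewrite /clamp le_max lexx ge_max T0 ge_min lexx. Qed.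

Lemma clamp_le T s t : s <= t -> clamp T s <= clamp T t.
Proof.
by move=> st; rewrite /clamp ge_max !le_max lexx/= le_min !ge_min lexx st !orbT.
Qed.

Lemma clamp_increment T s t : s <= t -> clamp T t - clamp T s <= t - s.
Proof.
move=> st; rewrite lerBlDl {1}/clamp ge_max; apply/andP; split.
  by rewrite addr_ge0 ?subr_ge0// /clamp le_max lexx.
rewrite (@le_trans _ _ (Num.min T s + (t - s)))//; last first.
  by rewrite lerD2r /clamp le_max lexx orbT.
rewrite addr_minl le_min !ge_min lerDl subr_ge0 st/=.
by rewrite [s + _]addrC subrK lexx orbT.
Qed.

(** At a discontinuity of [r] the difference quotients are unbounded, and the
maximal inequality says that they exceed [d] only on a set of measure O(1 / d). *)
Lemma nondecreasing_continuous_ae (r : R -> R) lo hi :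
  {homo r : s t / s <= t} -> (forall t, lo <= r t <= hi) ->
  {ae mu, forall t : R, r s @[s --> t] --> r t}.
Proof.
move=> rnd rb.
have lohi : lo <= hi by have /andP[h1 h2] := rb 0; exact: le_trans h1 h2.
suff : mu.-negligible [set t | forall d, 0 < d -> exists s, d * `|s - t| < `|r s - r t|].
  apply: negligibleS => t /= nc d d0.
  apply: contrapT => /forallNP no; apply: nc.
  apply/cvgrPdist_le => e e0; near=> s.
  have := no s => /negP; rewrite -leNgt distrC => /le_trans; apply.
  rewrite -ler_pdivlMl// mulrC distrC.
  by near: s; apply: cvgr_dist_le; [exact: cvg_id|exact: divr_gt0].
apply: negligible_small => e e0.
pose d := (6 * (hi - lo) + 1) / e.
have d0 : 0 < d by rewrite divr_gt0//; lra.
have [U [mU Ule AU]] := monotone_maximal_inequality rnd rb d0.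
exists U; split => //; last by move=> t /(_ d d0); exact: AU.
have ed : e * d = 6 * (hi - lo) + 1 by rewrite /d mulrC divfK ?gt_eqF.
rewrite (le_trans Ule)// lee_fin ler_pdivrMr// ed; lra.
Unshelve. all: by end_near. Qed.

Context (lam : R -> R) (lam_bv : forall T, 0 < T -> bounded_variation 0 T lam).

Definition cumulative_variation t := fine (total_variation 0 t lam).

Lemma cumulative_variation_increment s t : 0 <= s -> s <= t ->
  `|lam t - lam s| <= cumulative_variation t - cumulative_variation s.
Proof.
move=> s0 st; have t0 := le_trans s0 st; rewrite /cumulative_variation.
have [t0'|tp] := leP t 0.
  have -> : s = t by apply/eqP; rewrite eq_le st/= (le_trans t0').
  by rewrite !subrr normr0.
have fin_t : total_variation 0 t lam \is a fin_num by apply/bounded_variationP => //; exact: lam_bv.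
have := total_variationD lam s0 st.
have := total_variation_ge lam st; have := total_variation_ge0 lam s0.
move: fin_t; move: (total_variation 0 t lam) (total_variation 0 s lam) (total_variation s t lam).
by move=> [a| |] [b| |] [c| |]//= _ _; rewrite lee_fin -EFinD => ac [->]; lra.
Qed.

(** The cumulative variation is monotone only on nonnegative times, so the
statement for monotone functions is applied to its restrictions to
[[0, n + 1]], extended by constants. *)
Lemma cumulative_variation_continuous_ae :
  {ae mu, forall t : R, 0 < t -> cumulative_variation s @[s --> t] --> cumulative_variation t}.
Proof.
have Vle s t : 0 <= s -> s <= t -> cumulative_variation s <= cumulative_variation t.
  by move=> s0 st; rewrite -subr_ge0 (le_trans _ (cumulative_variation_increment s0 st)).
have all n : {ae mu, forall t : R, cumulative_variation (clamp n.+1%:R s) @[s --> t] -->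
    cumulative_variation (clamp n.+1%:R t)}.
  apply: (@nondecreasing_continuous_ae (cumulative_variation \o clamp n.+1%:R)
    (cumulative_variation 0) (cumulative_variation n.+1%:R)) => [s t st|t] /=.
    by apply: Vle; [have /andP[] := clamp_itv s (ler0n _ n.+1)|exact: clamp_le].
  have /andP[c1 c2] := clamp_itv t (ler0n R n.+1).
  by rewrite !Vle.
have := negligible_bigcup all; apply: negligibleS => t /= nc.
apply: contrapT => no; apply: nc => t0.
pose n := Num.truncn t.
have tn : t < n.+1%:R by have /andP[] := truncn_itv (ltW t0).
have : ~ ~ cumulative_variation (clamp n.+1%:R s) @[s --> t] -->
    cumulative_variation (clamp n.+1%:R t).
  by move=> nc; apply: no; exists n.
move=> /contrapT; rewrite (clamp_id (ltW t0) (ltW tn)).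
apply: cvg_trans; apply: near_eq_cvg; near=> s.
have : s \in `]0, n.+1%:R[ by near: s; apply: near_in_itvoo; rewrite in_itv/= t0.
by rewrite in_itv/= => /andP[? ?]; rewrite clamp_id// ltW.
Unshelve. all: by end_near. Qed.

End Variation.

(** * Existence and uniqueness *)

Section CauchyProblem.
Context {R : realType} {H : completeNormedModType R} (ip : {dot H for @idfun R})
  (hH : hilbert_dot ip) (phi : H -> \bar R) (phi_convex : convex_efun phi)
  (phi_lsc : lower_semicontinuous phi) (phi_proper : proper_efun phi)
  (psi : H -> R)
  (g_sub : subgradient_map ip psi (gradient ip psi))
  (g_lip : lipschitz_on_balls (gradient ip psi))
  (E_min : R) (E_lb : forall z, (E_min%:E <= phi z + (psi z)%:E)%E)
  (lam : R -> R) (lam_bv : forall T, 0 < T -> bounded_variation 0 T lam)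
  (lam_min : forall T, 0 < T ->
    exists2 m, 0 < m & forall t, 0 <= t -> t <= T -> m <= lam t)
  (x0 v0 : H) (v0_sub : subdifferential ip phi x0 v0).

Local Notation dphi := (subdifferential ip phi).
Local Notation g := (gradient ip psi).
Local Notation V := (cumulative_variation lam).
Local Notation mu := (@lebesgue_measure R).

Let lamV := cumulative_variation_increment lam_bv.

Lemma ae_impl (P Q : R -> Prop) : (forall t, P t -> Q t) ->
  {ae mu, forall t : R, P t} -> {ae mu, forall t : R, Q t}.
Proof. by move=> PQ; apply: negligibleS => t /= nQ /PQ. Qed.

Lemma lipschitz_derivable_nonneg (f : R -> H) :
  (forall T, 0 < T -> exists2 C, 0 <= C &
    forall s t, 0 <= s -> s <= t -> t <= T -> `|f t - f s| <= C * (t - s)) ->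
  {ae mu, forall t : R, 0 < t -> derivable f t 1}.
Proof.
move=> fL.
have all n : {ae mu, forall t : R, derivable (f \o clamp n.+1%:R) t 1}.
  have T0 : 0 < n.+1%:R :> R by [].
  have [C C0 CP] := fL _ T0.
  have key s t : s <= t -> `|f (clamp n.+1%:R t) - f (clamp n.+1%:R s)| <= C * (t - s).
    move=> st; have /andP[s0 sT] := clamp_itv s (ltW T0).
    have /andP[t0 tT] := clamp_itv t (ltW T0).
    rewrite (le_trans (CP _ _ s0 (clamp_le _ st) tT))// ler_wpM2l//.
    exact: clamp_increment.
  apply: (lipschitz_derivable_ae hH (L := C)) => s t /=.
  case: (leP s t) => [st|/ltW st].
    by rewrite (ger0_norm (_ : 0 <= t - s)) ?subr_ge0//; exact: key.
  by rewrite distrC (distrC t) (ger0_norm (_ : 0 <= s - t)) ?subr_ge0//; exact: key.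
have := negligible_bigcup all; apply: negligibleS => t /= nd.
apply: contrapT => no; apply: nd => t0.
pose n := Num.truncn t.
have tn : t < n.+1%:R by have /andP[] := truncn_itv (ltW t0).
have : ~ ~ derivable (f \o clamp n.+1%:R) t 1 by move=> nc; apply: no; exists n.
move=> /contrapT; apply: near_eq_derivable; near=> s => /=.
have : s \in `]0, n.+1%:R[ by near: s; apply: near_in_itvoo; rewrite in_itv/= t0.
by rewrite in_itv/= => /andP[? ?]; rewrite clamp_id// ltW.
Unshelve. all: by end_near. Qed.

(** At a point [t > 0] where [x] and [v] are derivable and the cumulative variation
is continuous, the defect of the limit curve over [[t, u]] is [o(u - t)], while
its first order expansion is [u - t] times the left-hand side of the equation. *)
Lemma cauchy_problem_existence : exists x v : R -> H,
  strong_solution ip phi psi lam x0 v0 x v.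
Proof.
have [x [v [x00 v00 xv bounds]]] := euler_limit hH phi_convex phi_lsc phi_proper
  g_sub g_lip E_lb lamV lam_min v0_sub.
have xL T : 0 < T -> exists2 C, 0 <= C &
    forall s t, 0 <= s -> s <= t -> t <= T -> `|x t - x s| <= C * (t - s).
  by move=> /bounds[C C0 CP]; exists C => // s t s0 st tT; have [] := CP s t s0 st tT.
have vL T : 0 < T -> exists2 C, 0 <= C &
    forall s t, 0 <= s -> s <= t -> t <= T -> `|v t - v s| <= C * (t - s).
  by move=> /bounds[C C0 CP]; exists C => // s t s0 st tT; have [] := CP s t s0 st tT.
exists x, v; split => //.
- by move=> b /xL[C C0 CP]; exact: lipschitz_abs_continuous CP.
- by move=> b /vL[C C0 CP]; exact: lipschitz_abs_continuous CP.
have dx := lipschitz_derivable_nonneg xL; have dv := lipschitz_derivable_nonneg vL.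
have cV := cumulative_variation_continuous_ae lam_bv.
have z0 : mu.-negligible [set 0 : R].
  by exists [set 0]; split => //; rewrite lebesgue_measure_set1.
have := negligibleU (negligibleU dx dv) (negligibleU cV z0).
apply: negligibleS => t /= nt; apply: contrapT => no; apply: nt => t0.
have tp : 0 < t.
  by rewrite lt_neqAle t0 andbT; apply/eqP => t00; apply: no; right; right.
have {}dx : derivable x t 1 by apply: contrapT => nd; apply: no; left; left => /(_ tp).
have {}dv : derivable v t 1 by apply: contrapT => nd; apply: no; left; right => /(_ tp).
have {}cV : V s @[s --> (t : R)] --> V t.
  by apply: contrapT => nd; apply: no; right; left => /(_ tp).
split => //.
have T0 : 0 < t + 1 by lra.
have [C C0 CP] := bounds _ T0.
have lt0 : 0 < lam t by exact: (lam_gt0 lam_min).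
set E := (X in X = 0).
suff : `|E| <= 0 by rewrite normr_le0 => /eqP.
apply: (@le0_of_small_multiples _ _ (C * 2 + lam t + 1)) => e e0 e1.
have [r1 r10 h1] := derivable_expansion dx e0.
have [r2 r20 h2] := derivable_expansion dv e0.
have [u [tu ur1 ur2 Vu ue]] : exists u,
    [/\ t < u, u - t < r1, u - t < r2, V u - V t <= e & u - t < e].
  near (t : R)^'+ => u; exists u; split.
  - by near: u; exact: nbhs_right_gt.
  - by rewrite ltrBlDl; near: u; apply: nbhs_right_lt; rewrite ltrDl.
  - by rewrite ltrBlDl; near: u; apply: nbhs_right_lt; rewrite ltrDl.
  - have : `|V t - V u| <= e.
      near: u; have /cvgrPdist_le := cvg_at_right_filter cV; exact.
    by rewrite distrC; exact: le_trans (ler_norm _).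
  - by rewrite ltrBlDl; near: u; apply: nbhs_right_lt; rewrite ltrDl.
have ut : 0 < u - t by lra.
have [_ _ /(_ tp cV) res] := CP t u t0 (ltW tu) (ltac:(lra)).
have := h1 u; have := h2 u; rewrite (gtr0_norm ut) => /(_ ur2) k2 /(_ ur1) k1.
rewrite -(ler_pM2r ut).
have -> : `|E| * (u - t) = `|residual g (lam t) (u - t) (x t) (v t) (x u) (v u)
   - lam t *: (x u - x t - (u - t) *: derive1 x t) - (v u - v t - (u - t) *: derive1 v t)|.
  rewrite -[u - t in LHS](gtr0_norm ut) mulrC -normrZ; congr (`|_|).
  by apply: (ip_ext hH) => w; rewrite /E /residual !(ipDl, ipNl, ipZl); ring.
rewrite (le_trans (ler_normB _ _))// (le_trans (lerD (ler_normB _ _) (lexx _)))//.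
rewrite normrZ (gtr0_norm lt0).
have := ler_wpM2l (ltW lt0) k1.
have : C * (u - t) * (V u - V t + (u - t)) <= C * (u - t) * (2 * e).
  by rewrite ler_wpM2l//; [rewrite mulr_ge0// ltW|lra].
by lra.
Unshelve. all: by end_near. Qed.

Lemma abs_continuous_bounded (f : R -> H) a b : a <= b -> abs_continuous_on a b f ->
  exists B, forall t, a <= t -> t <= b -> `|f t| <= B.
Proof.
move=> ab fac; have [d d0 fd] := fac 1 ltr01.
have unif s t : a <= s -> s <= t -> t <= b -> t - s < d -> `|f t - f s| <= 1.
  move=> as_ st tb std.
  have := fd 1%N (fun=> s) (fun=> t); rewrite !big_ord1 => h; apply/ltW/h => //.
  by move=> i j _ _ _; rewrite !ord1.
apply: (@interval_induction R
  (fun s u => exists B, forall t, s <= t -> t <= u -> `|f t| <= B)) => //.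
  move=> s m t _ sm mt _ [B1 h1] [B2 h2]; exists (Num.max B1 B2) => w sw wt.
  rewrite le_max; have [wm|/ltW mw] := leP w m; first by rewrite h1.
  by rewrite h2// orbT.
move=> t at_ tb; exists d => // s u as_ st tu ub sd ud; exists (`|f t| + 1) => w sw wu.
rewrite -[f w](subrK (f t)) addrC (le_trans (ler_normD _ _))// lerD2l.
have [wt|/ltW tw] := leP w t; last by apply: unif => //; lra.
by rewrite distrC; apply: unif => //; lra.
Qed.

(** Where the equation holds, [ip (derive1 x t) (derive1 v t) >= 0] as a limit of
products of increments in a monotone graph; so both derivatives are bounded
by the bounded quantity [v + g x], and [x], [v] are Lipschitz. The defect over
[[s, t]] is then the increment of a curve whose derivative involves only the
changes of [lam], [v] and [g x] since the time [s]. *)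
Lemma strong_solution_consistent x v T : 0 < T ->
  strong_solution ip phi psi lam x0 v0 x v ->
  exists2 C, 0 <= C & (forall t, 0 <= t -> t <= T -> `|x t| <= C) /\
    forall s t, 0 <= s -> s <= t -> t <= T ->
      `|residual g (lam s) (t - s) (x s) (v s) (x t) (v t)|
        <= C * (t - s) * (V t - V s + (t - s)).
Proof.
move=> T0 [xac vac xvE xv _].
have [Bx xB] := abs_continuous_bounded (ltW T0) (xac T T0).
have [Bv vB] := abs_continuous_bounded (ltW T0) (vac T T0).
have Bx0 : 0 <= Bx by rewrite (le_trans _ (xB 0 (lexx _) (ltW T0))).
have Bv0 : 0 <= Bv by rewrite (le_trans _ (vB 0 (lexx _) (ltW T0))).
have [G G0 gG] := g_bounded g_lip Bx; have [L L0 gL] := g_lip Bx.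
have [m m0 mlam] := lam_min T0.
pose K := (Bv + G) + (Bv + G) / m.
have BG0 : 0 <= Bv + G by rewrite addr_ge0.
have BGm : 0 <= (Bv + G) / m by rewrite divr_ge0// ltW.
have K0 : 0 <= K by rewrite addr_ge0.
have speed t : 0 < t -> t <= T -> derivable x t 1 -> derivable v t 1 ->
    lam t *: derive1 x t + derive1 v t + v t + g (x t) = 0 ->
    `|derive1 x t| <= K /\ `|derive1 v t| <= K.
  move=> t0 tT dx dv eq.
  have mon : 0 <= ip (derive1 x t) (derive1 v t).
    rewrite !derive1E; apply: cvgr_to_ge (cvg_ip hH _ dx dv) _.
    near=> h; rewrite [h *: 1]mulr1 ipZl ipZr mulrA -expr2 mulr_ge0 ?sqr_ge0//.
    apply: (subdifferential_monotone phi_proper); apply: xv; last exact: ltW.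
    have : `|h| < t by near: h; exact: dnbhs0_lt.
    by rewrite ltr_norml /= => /andP[ht _]; rewrite -lerBlDr sub0r ltW.
  have e : lam t *: derive1 x t + derive1 v t = - (v t + g (x t)).
    by apply/eqP; rewrite -subr_eq0 opprK addrA; apply/eqP.
  have le : `|lam t *: derive1 x t + derive1 v t| <= Bv + G.
    have t0' := ltW t0.
    by rewrite e normrN (le_trans (ler_normD _ _))// lerD// ?vB// gG// xB.
  have mt : m <= lam t by apply: mlam => //; exact: ltW.
  have lt0 : 0 <= lam t by rewrite (le_trans (ltW m0)).
  split.
    apply: (@le_trans _ _ ((Bv + G) / m)); last by rewrite lerDr.
    rewrite ler_pdivlMr// mulrC (le_trans _ le)//.
    by rewrite (le_trans _ (monotone_norml hH lt0 mon))// ler_wpM2r.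
  by rewrite (le_trans (monotone_normr hH lt0 mon))// (le_trans le)// lerDl.
have xL s t : 0 <= s -> s <= t -> t <= T -> `|x t - x s| <= K * (t - s).
  move=> s0 st tT; apply: abs_continuous_bound => //.
    exact: abs_continuous_onS s0 tT (xac T T0).
  apply: ae_impl xvE => w + sw wt.
  have w0 : 0 < w by lra.
  case/(_ (ltW w0)) => dx dv eq; apply: derivable_growth => //.
  by have [] := speed w w0 (ltac:(lra)) dx dv eq.
have vL s t : 0 <= s -> s <= t -> t <= T -> `|v t - v s| <= K * (t - s).
  move=> s0 st tT; apply: abs_continuous_bound => //.
    exact: abs_continuous_onS s0 tT (vac T T0).
  apply: ae_impl xvE => w + sw wt.
  have w0 : 0 < w by lra.
  case/(_ (ltW w0)) => dx dv eq; apply: derivable_growth => //.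
  by have [] := speed w w0 (ltac:(lra)) dx dv eq.
exists (Bx + K * (2 + L)).
  by rewrite addr_ge0// mulr_ge0// addr_ge0.
split=> [w w0 wT|s t s0 st tT].
  by rewrite (le_trans (xB w w0 wT))// lerDl mulr_ge0// addr_ge0.
have t0 := le_trans s0 st; have sT := le_trans st tT.
have ls : 0 < lam s by exact: (lam_gt0 lam_min).
have Vst : 0 <= V t - V s by rewrite (le_trans _ (lamV s0 st)).
(* The increments of [f] from [s] are the residuals with coefficient [lam s]. *)
pose f w := lam s *: x w + v w + w *: (v s + g (x s)).
have fE a b : f b - f a = lam s *: (x b - x a) + (v b - v a) + (b - a) *: (v s + g (x s)).
  by apply: (ip_ext hH) => w; rewrite /f !(ipDl, ipNl, ipZl); ring.
rewrite /residual -fE.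
pose M := (K * (2 + L)) * (V t - V s + (t - s)).
have ts : 0 <= t - s by lra.
have M0 : 0 <= M by rewrite !mulr_ge0// addr_ge0.
apply: (@le_trans _ _ (M * (t - s))); last first.
  rewrite /M mulrAC; apply: ler_wpM2r; first exact: addr_ge0.
  by apply: ler_wpM2r => //; rewrite lerDr.
apply: abs_continuous_bound => //.
  apply: (@lipschitz_abs_continuous _ _ _ _ _ (lam s * K + K + `|v s + g (x s)|)) => a b sa ab bt.
  have a0 := le_trans s0 sa; have bT := le_trans bt tT.
  rewrite fE (le_trans (ler_normD _ _))// (le_trans (lerD (ler_normD _ _) (lexx _)))//.
  rewrite !normrZ (gtr0_norm ls) (ger0_norm (_ : 0 <= b - a)) ?subr_ge0//.
  by have := ler_wpM2l (ltW ls) (xL a b a0 ab bT); have := vL a b a0 ab bT; lra.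
apply: ae_impl xvE => w + sw wt e e0.
have w0 : 0 < w by lra.
have wT : w <= T by lra.
case/(_ (ltW w0)) => dx dv eq.
have [sx sv] := speed w w0 wT dx dv eq.
pose e' := e / (lam s + 1).
have e'0 : 0 < e' by rewrite divr_gt0//; lra.
have [r1 r10 h1] := derivable_expansion dx e'0.
have [r2 r20 h2] := derivable_expansion dv e'0.
exists (Num.min r1 r2); first by rewrite lt_min r10.
move=> z; rewrite lt_min => /andP[/h1 k1 /h2 k2].
have dE : lam s *: derive1 x w + derive1 v w + (v s + g (x s)) =
    (- (lam w - lam s)) *: derive1 x w - (v w - v s) - (g (x w) - g (x s)).
  apply/eqP; rewrite -subr_eq0 -eq; apply/eqP.
  by apply: (ip_ext hH) => y; rewrite !(ipDl, ipNl, ipZl); ring.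
have dle : `|lam s *: derive1 x w + derive1 v w + (v s + g (x s))| <= M.
  rewrite dE (le_trans (ler_normB _ _))// (le_trans (lerD (ler_normB _ _) (lexx _)))//.
  rewrite normrZ normrN.
  have l1 := lamV s0 (ltW sw); have l2 := lamV (ltW w0) (ltW wt).
  have b1 : `|lam w - lam s| * `|derive1 x w| <= (V t - V s) * K.
    by apply: ler_pM => //; have := normr_ge0 (lam t - lam w); lra.
  have b2 := vL s w s0 (ltW sw) wT.
  have b3 : `|g (x w) - g (x s)| <= L * (K * (w - s)).
    rewrite (le_trans (gL _ _ (xB w (ltW w0) wT) (xB s s0 sT)))// ler_wpM2l//.
    exact: xL s0 (ltW sw) wT.
  have b4 : K * (w - s) <= K * (t - s) by rewrite ler_wpM2l//; lra.
  have b5 : L * (K * (w - s)) <= L * (K * (t - s)) by rewrite ler_wpM2l.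
  have := mulr_ge0 K0 Vst; have := mulr_ge0 (mulr_ge0 L0 K0) Vst; have := mulr_ge0 K0 ts.
  by rewrite /M; lra.
have -> : f z - f w = lam s *: (x z - x w - (z - w) *: derive1 x w)
   + (v z - v w - (z - w) *: derive1 v w)
   + (z - w) *: (lam s *: derive1 x w + derive1 v w + (v s + g (x s))).
  by apply: (ip_ext hH) => y; rewrite /f !(ipDl, ipNl, ipZl); ring.
rewrite (le_trans (ler_normD _ _))// (le_trans (lerD (ler_normD _ _) (lexx _)))//.
rewrite !normrZ (gtr0_norm ls).
have e'E : e' * (lam s + 1) = e by rewrite divfK// gt_eqF//; lra.
have := ler_wpM2l (ltW ls) k1; have := ler_wpM2l (normr_ge0 (z - w)) dle.
rewrite -e'E; lra.
Unshelve. all: by end_near. Qed.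

(** Both solutions satisfy the one-step estimate on the grid of step [t / N], so they
differ at time [t] by O(t / N), for every [N]. *)
Lemma cauchy_problem_uniqueness x v y u :
  strong_solution ip phi psi lam x0 v0 x v ->
  strong_solution ip phi psi lam x0 v0 y u ->
  forall t, 0 <= t -> y t = x t /\ u t = v t.
Proof.
move=> xs ys t; rewrite le_eqVlt => /orP[/eqP <-|t0].
  by case: xs => _ _ _ _ [-> ->]; case: ys => _ _ _ _ [-> ->].
have [Cx Cx0 [xC xr]] := strong_solution_consistent t0 xs.
have [Cy Cy0 [yC yr]] := strong_solution_consistent t0 ys.
have C0 : 0 <= Cx + Cy by rewrite addr_ge0.
have [D D0 DP] := grid_stability hH phi_proper g_lip lamV lam_min t0 C0.
have small N : (0 < N)%N -> `|y t - x t| <= D * (t / N%:R) /\ `|u t - v t| <= D * (t / N%:R).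
  move=> N0; pose h := t / N%:R.
  have Np : 0 < N%:R :> R by rewrite ltr0n.
  have h0 : 0 < h by rewrite divr_gt0.
  have Nh : N%:R * h = t by rewrite mulrC divfK// gt_eqF.
  have grid k : (k <= N)%N -> 0 <= k%:R * h /\ k%:R * h <= t.
    by move=> kN; rewrite mulr_ge0 ?(ltW h0)// -Nh ler_pM2r// ler_nat.
  have := DP N h (fun k => y (k%:R * h)) (fun k => u (k%:R * h))
    (fun k => x (k%:R * h)) (fun k => v (k%:R * h)) h0.
  rewrite Nh; apply.
  - done.
  - move=> k kN; have [k0 _] := grid k (ltnW kN); have [_ kt] := grid k.+1 kN.
    have kh : k.+1%:R * h - k%:R * h = h by rewrite -mulrBl -natr1 addrC addKr mul1r.
    have kk : k%:R * h <= k.+1%:R * h by lra.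
    have := yr _ _ k0 kk kt; rewrite kh => /le_trans; apply.
    apply: ler_wpM2r; first by rewrite addr_ge0 ?(ltW h0)// (le_trans _ (lamV k0 kk)).
    by apply: ler_wpM2r; rewrite ?(ltW h0)// lerDr.
  - move=> k kN; have [k0 _] := grid k (ltnW kN); have [_ kt] := grid k.+1 kN.
    have kh : k.+1%:R * h - k%:R * h = h by rewrite -mulrBl -natr1 addrC addKr mul1r.
    have kk : k%:R * h <= k.+1%:R * h by lra.
    have := xr _ _ k0 kk kt; rewrite kh => /le_trans; apply.
    apply: ler_wpM2r; first by rewrite addr_ge0 ?(ltW h0)// (le_trans _ (lamV k0 kk)).
    by apply: ler_wpM2r; rewrite ?(ltW h0)// lerDl.
  - by move=> k /grid[k0 _]; case: ys => _ _ _ + _; apply.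
  - by move=> k /grid[k0 _]; case: xs => _ _ _ + _; apply.
  - by move=> k /grid[k0 kt]; rewrite (le_trans (yC _ k0 kt))// lerDr.
  - by move=> k /grid[k0 kt]; rewrite (le_trans (xC _ k0 kt))// lerDl.
  - by rewrite mul0r; case: xs => _ _ _ _ [-> _]; case: ys => _ _ _ _ [-> _].
  - by rewrite mul0r; case: xs => _ _ _ _ [_ ->]; case: ys => _ _ _ _ [_ ->].
have zero (a : R) : (forall N, (0 < N)%N -> a <= D * (t / N%:R)) -> a <= 0.
  move=> aN; rewrite leNgt; apply/negP => a0.
  have /andP[_] := truncn_itv (divr_ge0 (mulr_ge0 D0 (ltW t0)) (ltW a0)).
  have := aN _ (ltn0Sn (Num.truncn (D * t / a))).
  by rewrite mulrA ler_pdivlMr ?ltr0Sn// ltr_pdivrMr// mulrC leNgt => /negbTE ->.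
split; apply/eqP; rewrite -subr_eq0 -normr_le0; apply: zero => N /small[] //.
Qed.

End CauchyProblem.
Theorem corollary4p4 (R : realType) (H : completeNormedModType R)
    (ip : {dot H for @idfun R}) (hH : hilbert_dot ip)
    (phi : H -> \bar R)
    (phi_convex : convex_efun phi)
    (phi_lsc : lower_semicontinuous phi)
    (phi_proper : proper_efun phi)
    (psi : H -> R)
    (psi_convex : convex_function (setT : set (convex_lmodType H)) psi)
    (psi_diff : forall z : H, differentiable psi z)
    (psi_lip : lipschitz_on_bounded_sets (gradient ip psi))
    (phipsi_lb : exists m : R, forall z : H, (m%:E <= phi z + (psi z)%:E)%E)
    (lambda : R -> R)
    (lambda_gt0 : forall t : R, 0 <= t -> 0 < lambda t)
    (lambda_bv : forall T : R, 0 < T -> bounded_variation 0 T lambda)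
    (lambda_inf : forall T : R, 0 < T -> 0 < inf (lambda @` `[0, T]))
    (x0 v0 : H)
    (v0_sub : subdifferential ip phi x0 v0)
    (v0_neq0 : v0 <> 0) :
  exists x v : R -> H,
    strong_solution ip phi psi lambda x0 v0 x v /\
    forall x' v' : R -> H,
      strong_solution ip phi psi lambda x0 v0 x' v' ->
      forall t : R, 0 <= t -> x' t = x t /\ v' t = v t.
Proof.
have [E_min E_lb] := phipsi_lb.
have g_sub := gradient_subgradient hH psi_convex psi_diff.
have g_lip := gradient_lipschitz_balls psi_lip.
have lam_min T : 0 < T -> exists2 m, 0 < m & forall t, 0 <= t -> t <= T -> m <= lambda t.
  move=> T0; exists (inf (lambda @` `[0, T])); first exact: lambda_inf.
  move=> t t0 tT; apply: ge_inf.
    by exists 0 => r [s /=]; rewrite in_itv/= => /andP[s0 _] <-; rewrite ltW// lambda_gt0.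
  by exists t => //; rewrite /= in_itv/= t0.
have [x [v xv]] := cauchy_problem_existence hH phi_convex phi_lsc phi_proper
  g_sub g_lip E_lb lambda_bv lam_min v0_sub.
exists x, v; split => // x' v' xv'.
exact: (cauchy_problem_uniqueness hH phi_proper g_lip lambda_bv lam_min xv xv').
Qed.
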